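(* Suppose that the following seven identities hold for all complex $q$ with $0<|q|<1$: (i) $\displaystyle -\sum_{m}(-1)^m\frac{q^{(7m^2+3m)/2}}{1-q^{7m+1}}+\sum_{m}(-1)^m\frac{q^{(7m^2-3m)/2}}{1-q^{7m-2}}=(q^7;q^7)_\infty^2\left(-\frac{L^2(q)}{N(q)}+q\frac{Q(q)N(q)}{L(q)}\right)$; (ii) $\displaystyle 4\sum_{m}(-1)^m\frac{q^{(7m^2+5m)/2}}{1-q^{7m+1}}+4\sum_{m}(-1)^m\frac{q^{(7m^2+9m+2)/2}}{1-q^{7m+3}}=(q^7;q^7)_\infty^2\left(\frac{L(q)N(q)}{Q(q)}+3\frac{L^2(q)Q(q)}{N^2(q)}+q\frac{Q^2(q)}{L(q)}\right)$; (iii) $\displaystyle \sum_{m}(-1)^m\frac{q^{(7m^2+5m)/2}}{1-q^{7m+2}}-\sum_{m}(-1)^m\frac{q^{(7m^2-5m)/2}}{1-q^{7m-3}}-5\sum_{m}(-1)^m\frac{q^{(7m^2+7m)/2}}{1-q^{7m+1}}=-4(q^7;q^7)_\infty^2L(q)$; (iv) $\displaystyle 5\sum_{m}(-1)^m\frac{q^{(7m^2+m-2)/2}}{1-q^{7m-2}}-5\sum_{m}(-1)^m\frac{q^{(7m^2-m-2)/2}}{1-q^{7m-3}}=(q^7;q^7)_\infty^2\left(2\frac{N^2(q)}{Q(q)}-2\frac{L(q)Q(q)}{N(q)}-3q\frac{Q^2(q)N(q)}{L^2(q)}\right)$; (v) $\displaystyle -4\sum_{m}(-1)^m\frac{q^{(7m^2+7m)/2}}{1-q^{7m+2}}-5\sum_{m}(-1)^m\frac{q^{(7m^2+3m-2)/2}}{1-q^{7m-1}}-5\sum_{m}(-1)^m\frac{q^{(7m^2+11m+2)/2}}{1-q^{7m+3}}=(q^7;q^7)_\infty^2N(q)$;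 (vi) $\displaystyle -\sum_{m}(-1)^m\frac{q^{(7m^2+7m)/2}}{1-q^{7m+3}}+4\sum_{m}(-1)^m\frac{q^{(7m^2+m-2)/2}}{1-q^{7m-1}}-4\sum_{m}(-1)^m\frac{q^{(7m^2-m-2)/2}}{1-q^{7m-2}}=-5(q^7;q^7)_\infty^2Q(q)$; (vii) $\displaystyle {\sum_{m}}'(-1)^m\frac{q^{(7m^2+m-2)/2}}{1-q^{7m}}-\sum_{m}(-1)^m\frac{q^{(7m^2-m-2)/2}}{1-q^{7m-1}}-4{\sum_{m}}'(-1)^m\frac{q^{(7m^2+3m-2)/2}}{1-q^{7m}}+4\sum_{m}(-1)^m\frac{q^{(7m^2-3m-2)/2}}{1-q^{7m-3}}+5{\sum_{m}}'(-1)^m\frac{q^{(7m^2+5m-2)/2}}{1-q^{7m}}+5\sum_{m}(-1)^m\frac{q^{(7m^2+9m)/2}}{1-q^{7m+2}}=3(q^7;q^7)_\infty^2\left(\frac{Q^2(q)}{N(q)}+\frac{N^2(q)}{L(q)}\right)$. Then for all such $q$, $$\frac{1}{(q;q)_\infty}\sum_{n\ge1}\frac{(-1)^nq^{n(n+1)/2}(1-q^n)^5(1+q^n)}{1-q^{7n}}=-qA+3q^2B-2q^3C+q^4D-3q^6E,$$ where $$A=\frac{(q^{49};q^{49})_\infty}{(q^7,q^{42};q^{49})_\infty},\quad B=\frac{(q^{14},q^{35},q^{49};q^{49})_\infty}{(q^7,q^{21},q^{28},q^{42};q^{49})_\infty},\quad C=\frac{(q^{49};q^{49})_\infty}{(q^{14},q^{35};q^{49})_\infty},$$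 $$D=\frac{(q^{49};q^{49})_\infty}{(q^{21},q^{28};q^{49})_\infty},\quad E=\frac{(q^7,q^{42},q^{49};q^{49})_\infty}{(q^{14},q^{21},q^{28},q^{35};q^{49})_\infty}.$$
   Context: Notation: $(A;q)_\infty=\prod_{m=0}^{\infty}(1-Aq^m)$ and $(A_1,\dots,A_r;q)_\infty=\prod_{t=1}^r(A_t;q)_\infty$. $\sum_m$ denotes the sum over all integers $m$, and $\sum_m'$ the sum over all nonzero integers $m$. $L(q)=\dfrac{1}{(q,q^6;q^7)_\infty}$, $N(q)=\dfrac{1}{(q^2,q^5;q^7)_\infty}$, $Q(q)=\dfrac{1}{(q^3,q^4;q^7)_\infty}$. *)

(* Defs.v *)
From Stdlib Require Export Reals ZArith List.
From Coquelicot Require Export Coquelicot.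
Export ListNotations.

Open Scope R_scope.
Open Scope C_scope.

(* As for [RInt], the limit operators below are total: they are meaningful
   when the limit exists ([Clim_seq_unique], [CSeries_unique]). *)
Definition Clim_seq (u : nat -> C) : C :=
  iota (fun l : C_CompleteNormedModule =>
          filterlim u eventually (@locally C_CompleteNormedModule l)).

Definition CSeries (a : nat -> C) : C :=
  iota (fun l : C_CompleteNormedModule =>
          @is_series C_AbsRing C_CompleteNormedModule a l).

Lemma Clim_seq_unique (u : nat -> C) (l : C) :
  filterlim u eventually (@locally C_CompleteNormedModule l) ->
  Clim_seq u = l.
Proof.
intros H; apply (iota_unique (V := C_CompleteNormedModule)); [|exact H].
intros y Hy.
exact (filterlim_locally_unique (V := C_CompleteNormedModule) u y l Hy H).
Qed.

Lemma CSeries_unique (a : nat -> C) (l : C) :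
  @is_series C_AbsRing C_CompleteNormedModule a l -> CSeries a = l.
Proof.
intros H; apply (iota_unique (V := C_CompleteNormedModule)); [|exact H].
intros y Hy.
exact (filterlim_locally_unique (V := C_CompleteNormedModule) _ y l Hy H).
Qed.

(* Sums over all integers, resp. all nonzero integers, as two one-sided
   series; the bilateral series to which they are applied converge
   absolutely, so that the order of summation is irrelevant. *)
Definition ZSeries (f : Z -> C) : C :=
  CSeries (fun n => f (Z.of_nat n)) + CSeries (fun n => f (- Z.of_nat (S n))%Z).

Definition ZSeries_nz (f : Z -> C) : C :=
  CSeries (fun n => f (Z.of_nat (S n)))
  + CSeries (fun n => f (- Z.of_nat (S n))%Z).

Definition CpowZ (x : C) (k : Z) : C :=
  match k with
  | Z0 => 1
  | Zpos p => x ^ Pos.to_nat p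
  | Zneg p => / (x ^ Pos.to_nat p)
  end.

Notation "x ^^ k" := (CpowZ x k%Z)
  (at level 30, right associativity) : C_scope.

Fixpoint Cprod (u : nat -> C) (n : nat) : C :=
  match n with
  | O => 1
  | S p => Cprod u p * u p
  end.

Definition qpoch (A q : C) : C :=
  Clim_seq (Cprod (fun m => 1 - A * q ^ m)).

Definition qpochs (l : list C) (q : C) : C :=
  fold_right Cmult 1 (map (fun A => qpoch A q) l).

Definition Lq (q : C) : C := 1 / qpochs [q; q ^ 6] (q ^ 7).
Definition Nq (q : C) : C := 1 / qpochs [q ^ 2; q ^ 5] (q ^ 7).
Definition Qq (q : C) : C := 1 / qpochs [q ^ 3; q ^ 4] (q ^ 7).

Definition prodA (q : C) : C :=
  qpoch (q ^ 49) (q ^ 49) / qpochs [q ^ 7; q ^ 42] (q ^ 49).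
Definition prodB (q : C) : C :=
  qpochs [q ^ 14; q ^ 35; q ^ 49] (q ^ 49)
  / qpochs [q ^ 7; q ^ 21; q ^ 28; q ^ 42] (q ^ 49).
Definition prodC (q : C) : C :=
  qpoch (q ^ 49) (q ^ 49) / qpochs [q ^ 14; q ^ 35] (q ^ 49).
Definition prodD (q : C) : C :=
  qpoch (q ^ 49) (q ^ 49) / qpochs [q ^ 21; q ^ 28] (q ^ 49).
Definition prodE (q : C) : C :=
  qpochs [q ^ 7; q ^ 42; q ^ 49] (q ^ 49)
  / qpochs [q ^ 14; q ^ 21; q ^ 28; q ^ 35] (q ^ 49).

(* q^(e/2) / (1 - q^r) with alternating sign. In every use e = 7m^2 + bm + c
   with b odd and c even, hence e is even and the integer division is exact. *)
Definition aterm (q : C) (m e r : Z) : C :=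
  (-1) ^^ m * (q ^^ (e / 2) / (1 - q ^^ r)).

(* Main.v *)
Require Import Defs.
From Stdlib Require Import Lra Lia.
Open Scope R_scope.
Open Scope C_scope.

(** Expanding [(1 - x)^5 (1 + x)] and folding [n] to [- n], the left-hand series is
    the sum over all [n] of [(-1)^n q^(n(n+1)/2) (1 - 4 q^n + 5 q^(2n)) / (1 - q^(7n))].
    Splitting [n = 7m + r] with [-3 <= r <= 3] collects, by the residue of the exponent
    of [q] modulo 7, exactly the combinations evaluated by (i)-(vii) at [q^7].
    On the other side, with [L, N, Q] taken at [q^7] and [E = (q^49;q^49)], Euler's
    product is [(q;q) = E (L/N - q N/Q - q^2 + q^5 Q/L)], and multiplying it by
    [E (- q L + 3 q^2 LQ/N - 2 q^3 N + q^4 Q - 3 q^6 NQ/L)] gives the same seven values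
    term by term.  The dissection of [(q;q)] follows from the pentagonal number theorem
    and the quintuple product identity; both are limits of one finite identity, which is
    proved by telescoping in the spirit of Wilf and Zeilberger. *)

(** * Limits of complex sequences and bilateral series *)

(** The operators [CSeries], [ZSeries] and [qpoch] are total and by themselves say nothing about
    convergence, so splitting, reflecting or reindexing a bilateral sum requires convergence of both
    halves. All of it is drawn from one criterion, a two-sided geometric bound, which is stable
    under sums, scalings and affine changes of index; the quadratic exponents of [q] always supply
    it. The quintuple product is reached through a finite identity because the proof is then a check
    of rational functions, followed by dominated convergence. Its parameter [z] serves twice:
    [z = 1] yields the pentagonal number theorem, and [z = q ^ a] in base [q ^ 7], with
    [a = 1, 2, 3], yields the quotients L/N, N/Q and Q/L. The two uses fit together because the
    residue classes of the pentagonal series and both parts of the quintuple series belong to one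
    family of theta series, up to reflection and a single shift of index. *)

Definition clim (u : nat -> C) (l : C) : Prop :=
  forall eps : R, (0 < eps)%R ->
  exists N, forall n, (N <= n)%nat -> (Cmod (u n - l) < eps)%R.

Lemma clim_filterlim (u : nat -> C) (l : C) :
  clim u l <-> filterlim u eventually (@locally C_CompleteNormedModule l).
Proof.
split.
- intros H. apply (proj2 (filterlim_locally_ball_norm (K := C_AbsRing)
                     (U := C_NormedModule) (FF := filter_filter) u l)).
  intros eps. destruct (H eps (cond_pos eps)) as [N HN].
  exists N. intros n Hn. exact (HN n Hn).
- intros H eps Heps.
  destruct (proj1 (filterlim_locally_ball_norm (K := C_AbsRing)
                     (U := C_NormedModule) (FF := filter_filter) u l) H
              (mkposreal eps Heps)) as [N HN].
  exists N. intros n Hn. exact (HN n Hn).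
Qed.

Lemma clim_unique (u : nat -> C) (l1 l2 : C) : clim u l1 -> clim u l2 -> l1 = l2.
Proof.
intros H1%clim_filterlim H2%clim_filterlim.
exact (filterlim_locally_unique (V := C_CompleteNormedModule) u _ _ H1 H2).
Qed.

Lemma clim_ext (u v : nat -> C) (l : C) :
  (forall n, u n = v n) -> clim u l -> clim v l.
Proof.
intros E H eps Heps; destruct (H eps Heps) as [N HN].
exists N; intros n Hn; rewrite <- E; auto.
Qed.

Lemma clim_const (c : C) : clim (fun _ => c) c.
Proof.
intros eps Heps; exists 0%nat; intros n _.
replace (c - c) with (RtoC 0) by ring. now rewrite Cmod_0.
Qed.

Lemma clim_sub (u : nat -> C) (l : C) (s : nat -> nat) :
  (forall n, (n <= s n)%nat) -> clim u l -> clim (fun n => u (s n)) l.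
Proof.
intros Hs H eps Heps; destruct (H eps Heps) as [N HN].
exists N; intros n Hn; apply HN; specialize (Hs n); lia.
Qed.

Lemma clim_incr (u : nat -> C) (l : C) : clim (fun n => u (S n)) l -> clim u l.
Proof.
intros H eps Heps; destruct (H eps Heps) as [N HN].
exists (S N); intros [|n] Hn; [lia|]. apply HN; lia.
Qed.

Lemma clim_plus (u v : nat -> C) (l m : C) :
  clim u l -> clim v m -> clim (fun n => u n + v n) (l + m).
Proof.
intros Hu Hv eps Heps.
destruct (Hu (eps / 2)%R ltac:(lra)) as [N1 H1].
destruct (Hv (eps / 2)%R ltac:(lra)) as [N2 H2].
exists (N1 + N2)%nat; intros n Hn.
replace (u n + v n - (l + m)) with ((u n - l) + (v n - m)) by ring.
eapply Rle_lt_trans; [apply Cmod_triangle|].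
specialize (H1 n ltac:(lia)); specialize (H2 n ltac:(lia)); lra.
Qed.

Lemma clim_bounded (u : nat -> C) (l : C) :
  clim u l -> exists B, (0 < B)%R /\ forall n, (Cmod (u n) <= B)%R.
Proof.
intros H; destruct (H 1%R Rlt_0_1) as [N HN].
assert (Hfin : exists B, (0 < B)%R /\ forall n, (n < N)%nat -> (Cmod (u n) <= B)%R).
{ clear HN; induction N as [|N [B [HB IH]]].
  - exists 1%R; split; [lra|]; intros; lia.
  - exists (B + Cmod (u N))%R; pose proof (Cmod_ge_0 (u N)); split; [lra|].
    intros n Hn; destruct (Nat.eq_dec n N) as [->|]; [lra|].
    specialize (IH n ltac:(lia)); lra. }
destruct Hfin as [B [HB Hfin]].
exists (B + (1 + Cmod l))%R; pose proof (Cmod_ge_0 l); split; [lra|].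
intros n; destruct (le_lt_dec N n) as [Hn|Hn].
- specialize (HN n Hn).
  replace (u n) with ((u n - l) + l) by ring.
  pose proof (Cmod_triangle (u n - l) l); lra.
- specialize (Hfin n Hn); lra.
Qed.

Lemma clim_mult (u v : nat -> C) (l m : C) :
  clim u l -> clim v m -> clim (fun n => u n * v n) (l * m).
Proof.
intros Hu Hv eps Heps.
destruct (clim_bounded _ _ Hu) as [B [HB Bu]].
pose proof (Cmod_ge_0 m) as Hm.
assert (H1 : (0 < eps / (2 * B))%R) by (apply Rdiv_lt_0_compat; lra).
assert (H2 : (0 < eps / (2 * (Cmod m + 1)))%R) by (apply Rdiv_lt_0_compat; lra).
destruct (Hv _ H1) as [N1 K1]; destruct (Hu _ H2) as [N2 K2].
exists (N1 + N2)%nat; intros n Hn.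
replace (u n * v n - l * m) with (u n * (v n - m) + m * (u n - l)) by ring.
eapply Rle_lt_trans; [apply Cmod_triangle|]; rewrite !Cmod_mult.
specialize (K1 n ltac:(lia)); specialize (K2 n ltac:(lia)); specialize (Bu n).
apply Rle_lt_trans with (B * Cmod (v n - m) + (Cmod m + 1) * Cmod (u n - l))%R.
- pose proof (Cmod_ge_0 (v n - m)); pose proof (Cmod_ge_0 (u n - l)); nra.
- apply Rlt_le_trans
    with (B * (eps / (2 * B)) + (Cmod m + 1) * (eps / (2 * (Cmod m + 1))))%R.
  + apply Rplus_lt_compat; apply Rmult_lt_compat_l; lra.
  + right; field; lra.
Qed.

Lemma clim_scal (c : C) (u : nat -> C) (l : C) :
  clim u l -> clim (fun n => c * u n) (c * l).
Proof. intros H; apply clim_mult; [apply clim_const|exact H]. Qed.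

Lemma clim_Cmod_le (u : nat -> C) (l x : C) (B : R) :
  clim u l -> (exists N, forall n, (N <= n)%nat -> (Cmod (u n - x) <= B)%R) ->
  (Cmod (l - x) <= B)%R.
Proof.
intros H [N1 HB]; apply Rnot_lt_le; intros Hlt.
destruct (H (Cmod (l - x) - B)%R ltac:(lra)) as [N HN].
specialize (HN (N + N1)%nat ltac:(lia)); specialize (HB (N + N1)%nat ltac:(lia)).
set (w := u (N + N1)%nat) in *.
replace (l - x) with (- (w - l) + (w - x)) in Hlt, HN by ring.
pose proof (Cmod_triangle (- (w - l)) (w - x)); rewrite Cmod_opp in *; lra.
Qed.

(** * Partial sums and dominated convergence *)

Fixpoint psum (a : nat -> C) (n : nat) : C :=
  match n with O => 0 | S p => psum a p + a p end.

Lemma sum_n_psum (a : nat -> C) (n : nat) :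
  @sum_n (NormedModule.AbelianMonoid C_AbsRing C_NormedModule) a n = psum a (S n).
Proof.
induction n as [|n IH].
- rewrite sum_O; simpl; ring.
- rewrite sum_Sn, IH; reflexivity.
Qed.

Lemma is_series_psum (a : nat -> C) (l : C) :
  @is_series C_AbsRing C_CompleteNormedModule a l <-> clim (psum a) l.
Proof.
unfold is_series; split; intros H.
- apply clim_incr, clim_filterlim.
  eapply filterlim_ext; [|exact H]; intros n; apply (sum_n_psum a n).
- apply (clim_sub _ _ S) in H; [|intros; lia].
  apply clim_filterlim in H.
  eapply filterlim_ext; [|exact H]; intros n; symmetry; apply (sum_n_psum a n).
Qed.

Lemma CSeries_psum (a : nat -> C) (l : C) : clim (psum a) l -> CSeries a = l.
Proof. intros H; apply CSeries_unique, is_series_psum, H. Qed.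

Lemma psum_ext (a b : nat -> C) (n : nat) :
  (forall i, (i < n)%nat -> a i = b i) -> psum a n = psum b n.
Proof.
induction n as [|n IH]; intros H; simpl; [reflexivity|].
rewrite IH, (H n); auto with arith.
Qed.

Lemma psum_eq_0 (a : nat -> C) (n : nat) :
  (forall i, a i = 0) -> psum a n = 0.
Proof. intros H; induction n as [|n IH]; simpl; [|rewrite IH, H; ring]; reflexivity. Qed.

Lemma psum_plus (a b : nat -> C) (n : nat) :
  psum (fun i => a i + b i) n = psum a n + psum b n.
Proof. induction n as [|n IH]; simpl; [ring|rewrite IH; ring]. Qed.

Lemma psum_scal (c : C) (a : nat -> C) (n : nat) :
  psum (fun i => c * a i) n = c * psum a n.
Proof. induction n as [|n IH]; simpl; [ring|rewrite IH; ring]. Qed.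

Lemma psum_S_l (a : nat -> C) (n : nat) :
  psum a (S n) = a 0%nat + psum (fun i => a (S i)) n.
Proof. induction n as [|n IH]; [simpl; ring|]. simpl in *; rewrite IH; ring. Qed.

Lemma clim_psum_S (a : nat -> C) (l : C) :
  clim (psum a) l -> clim (psum (fun i => a (S i))) (l - a 0%nat).
Proof.
intros H; apply (clim_sub _ _ S) in H; [|intros; lia].
apply (clim_ext (fun n => psum a (S n) + (- a 0%nat))).
- intros n; rewrite psum_S_l; ring.
- apply clim_plus; [exact H|apply clim_const].
Qed.

Lemma psum_geom_cv (a : nat -> C) (M r : R) :
  (0 <= r < 1)%R -> (forall n, (Cmod (a n) <= M * r ^ n)%R) ->
  exists l, clim (psum a) l.
Proof.
intros Hr Ha.
destruct (ex_series_le (K := C_AbsRing) (V := C_CompleteNormedModule) a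
            (fun n => M * r ^ n)%R) as [l Hl].
- exact Ha.
- apply (ex_series_scal_l M (fun n => (r ^ n)%R)), ex_series_geom.
  rewrite Rabs_pos_eq; lra.
- exists l; apply is_series_psum, Hl.
Qed.

Lemma Cmod_psum_tail (a : nat -> C) (M r : R) (n m : nat) :
  (0 <= r < 1)%R -> (0 <= M)%R -> (forall k, (Cmod (a k) <= M * r ^ k)%R) ->
  (n <= m)%nat -> (Cmod (psum a m - psum a n) <= M * r ^ n / (1 - r))%R.
Proof.
intros Hr HM Ha Hnm.
(* The exact finite geometric sum is the bound that passes through the induction; the stated one is
   weaker. *)
assert (H : (Cmod (psum a m - psum a n) <= M * (r ^ n - r ^ m) / (1 - r))%R).
{ induction Hnm as [|m Hnm IH].
  - replace (psum a n - psum a n) with (RtoC 0) by ring. rewrite Cmod_0.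
    right; field; lra.
  - simpl psum. replace (psum a m + a m - psum a n)
      with ((psum a m - psum a n) + a m) by ring.
    eapply Rle_trans; [apply Cmod_triangle|].
    eapply Rle_trans; [apply Rplus_le_compat; [exact IH|apply Ha]|].
    right; simpl; field; lra. }
eapply Rle_trans; [exact H|].
apply Rmult_le_compat_r; [left; apply Rinv_0_lt_compat; lra|].
pose proof (pow_le r m ltac:(lra)); nra.
Qed.

(** Tannery's theorem for rows with known sums. For [n >= K] the [K]-th partial sum of row [n]
    differs from [l] by a geometric tail independent of [n]; letting [n] grow gives the same bound
    for [c]. One cutoff [m >= n] per row suffices, which suits rows of finite support. *)
Lemma tannery (b : nat -> nat -> C) (c : nat -> C) (l : C) (M r : R) :
  (0 <= r < 1)%R -> (0 <= M)%R ->
  (forall n k, (Cmod (b n k) <= M * r ^ k)%R) ->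
  (forall k, clim (fun n => b n k) (c k)) ->
  (forall n, exists m, (n <= m)%nat /\ psum (b n) m = l) ->
  clim (psum c) l.
Proof.
intros Hr HM Hb Hc Hl.
assert (Hfin : forall K, clim (fun n => psum (b n) K) (psum c K)).
{ intros K; induction K as [|K IH]; simpl; [apply clim_const|].
  apply clim_plus; [exact IH|apply Hc]. }
assert (Hbd : forall K, (Cmod (psum c K - l) <= M * r ^ K / (1 - r))%R).
{ intros K; apply (clim_Cmod_le _ _ _ _ (Hfin K)).
  exists K; intros n Hn; destruct (Hl n) as [m [Hm <-]].
  replace (psum (b n) K - psum (b n) m)
    with (- (psum (b n) m - psum (b n) K)) by ring.
  rewrite Cmod_opp; apply Cmod_psum_tail; auto; lia. }
intros eps Heps.
destruct (pow_lt_1_zero r ltac:(rewrite Rabs_pos_eq; lra)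
            (eps * (1 - r) / (M + 1))%R) as [N HN].
{ apply Rdiv_lt_0_compat; [apply Rmult_lt_0_compat|]; lra. }
exists N; intros n Hn; eapply Rle_lt_trans; [apply Hbd|].
specialize (HN n Hn); rewrite Rabs_pos_eq in HN by (apply pow_le; lra).
apply Rlt_div_l; [lra|].
apply Rle_lt_trans with ((M + 1) * r ^ n)%R.
- pose proof (pow_le r n ltac:(lra)); nra.
- apply Rlt_le_trans with ((M + 1) * (eps * (1 - r) / (M + 1)))%R.
  + apply Rmult_lt_compat_l; lra.
  + right; field; lra.
Qed.

(** The relational counterpart of [ZSeries]: it records that both halves converge, so it can be
    transported through reindexing where the total operator cannot. *)
Definition zlim (f : Z -> C) (l : C) : Prop :=
  exists l1 l2, clim (psum (fun n => f (Z.of_nat n))) l1 /\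
    clim (psum (fun n => f (- Z.of_nat (S n))%Z)) l2 /\ l = l1 + l2.

Lemma zlim_ZSeries (f : Z -> C) (l : C) : zlim f l -> ZSeries f = l.
Proof.
intros (l1 & l2 & H1 & H2 & ->); unfold ZSeries.
now rewrite (CSeries_psum _ _ H1), (CSeries_psum _ _ H2).
Qed.

Lemma zlim_ext (f g : Z -> C) (l : C) :
  (forall m, f m = g m) -> zlim f l -> zlim g l.
Proof.
intros E (l1 & l2 & H1 & H2 & ->); exists l1, l2.
split; [|split; [|reflexivity]].
- eapply clim_ext; [|exact H1]; intros n; apply psum_ext; auto.
- eapply clim_ext; [|exact H2]; intros n; apply psum_ext; auto.
Qed.

Lemma zlim_plus (f g : Z -> C) (l m : C) :
  zlim f l -> zlim g m -> zlim (fun k => f k + g k) (l + m).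
Proof.
intros (l1 & l2 & H1 & H2 & ->) (m1 & m2 & K1 & K2 & ->).
exists (l1 + m1), (l2 + m2); split; [|split; [|ring]].
- eapply clim_ext; [|exact (clim_plus _ _ _ _ H1 K1)].
  intros n; symmetry; apply (psum_plus (fun i => f (Z.of_nat i))).
- eapply clim_ext; [|exact (clim_plus _ _ _ _ H2 K2)].
  intros n; symmetry; apply (psum_plus (fun i => f (- Z.of_nat (S i))%Z)).
Qed.

Lemma zlim_scal (c : C) (f : Z -> C) (l : C) :
  zlim f l -> zlim (fun k => c * f k) (c * l).
Proof.
intros (l1 & l2 & H1 & H2 & ->).
exists (c * l1), (c * l2); split; [|split; [|ring]].
- eapply clim_ext; [|exact (clim_scal c _ _ H1)].
  intros n; symmetry; apply (psum_scal c (fun i => f (Z.of_nat i))).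
- eapply clim_ext; [|exact (clim_scal c _ _ H2)].
  intros n; symmetry; apply (psum_scal c (fun i => f (- Z.of_nat (S i))%Z)).
Qed.

Lemma clim_psum_cons (a : nat -> C) (l : C) :
  clim (psum (fun i => a (S i))) l -> clim (psum a) (a 0%nat + l).
Proof.
intros H; apply clim_incr.
apply (clim_ext (fun n => a 0%nat + psum (fun i => a (S i)) n)).
- intros n; now rewrite psum_S_l.
- apply clim_plus; [apply clim_const|exact H].
Qed.

Lemma zlim_shift (f : Z -> C) (l : C) :
  zlim f l -> zlim (fun k => f (k - 1)%Z) l.
Proof.
intros (l1 & l2 & H1 & H2 & ->).
exists (f (-1)%Z + l1), (l2 - f (-1)%Z); split; [|split; [|ring]].
- apply (clim_psum_cons (fun n => f (Z.of_nat n - 1)%Z)).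
  eapply clim_ext; [|exact H1]; intros n; apply psum_ext; intros i _.
  f_equal; lia.
- apply clim_psum_S in H2.
  eapply clim_ext; [|exact H2]; intros n; apply psum_ext; intros i _.
  f_equal; lia.
Qed.

Lemma zlim_opp (f : Z -> C) (l : C) :
  zlim f l -> zlim (fun k => f (- k)%Z) l.
Proof.
intros (l1 & l2 & H1 & H2 & ->).
exists (f 0%Z + l2), (l1 - f 0%Z); split; [|split; [|ring]].
- apply (clim_psum_cons (fun n => f (- Z.of_nat n)%Z)); exact H2.
- apply clim_psum_S in H1.
  eapply clim_ext; [|exact H1]; intros n; apply psum_ext; intros i _.
  f_equal; lia.
Qed.

(** * Dissection of sums modulo 7 *)

Lemma psum_add (a : nat -> C) (n m : nat) :
  psum a (n + m) = psum a n + psum (fun i => a (n + i)%nat) m.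
Proof.
induction m as [|m IH]; [rewrite Nat.add_0_r; simpl; ring|].
rewrite Nat.add_succ_r; simpl; rewrite IH; ring.
Qed.

Lemma psum_mul7 (a : nat -> C) (n : nat) :
  psum a (7 * n) = psum (fun m => psum (fun r => a (7 * m + r)%nat) 7) n.
Proof.
induction n as [|n IH]; [reflexivity|].
replace (7 * S n)%nat with (7 * n + 7)%nat by lia.
rewrite psum_add, IH; reflexivity.
Qed.

(** Convergence of the whole series is assumed, so its limit may be read off along the partial sums
    of length [7 n], which split by residue. *)
Lemma clim_psum7 (a : nat -> C) (l : C) (p : nat -> C) :
  clim (psum a) l ->
  (forall r, (r < 7)%nat -> clim (psum (fun m => a (7 * m + r)%nat)) (p r)) ->
  l = psum p 7.
Proof.
intros H Hp.
apply (clim_sub _ _ (fun n => 7 * n)%nat) in H; [|intros; lia].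
apply (clim_unique _ _ _ H).
apply (clim_ext (fun n => psum (fun r => psum (fun m => a (7 * m + r)%nat) n) 7)).
- intros k; rewrite psum_mul7; simpl.
  rewrite !psum_plus; simpl.
  now rewrite (psum_eq_0 (fun _ => 0)).
- simpl; repeat apply clim_plus; try apply clim_const; apply Hp; lia.
Qed.

Lemma zlim7 (f : Z -> C) (l : C) (p : nat -> C) :
  zlim f l ->
  (forall r, (r < 7)%nat -> zlim (fun m => f (7 * m + Z.of_nat r)%Z) (p r)) ->
  l = psum p 7.
Proof.
intros (l1 & l2 & H1 & H2 & ->) Hp.
destruct (Hp 0%nat ltac:(lia)) as (a0 & b0 & A0 & B0 & E0).
destruct (Hp 1%nat ltac:(lia)) as (a1 & b1 & A1 & B1 & E1).
destruct (Hp 2%nat ltac:(lia)) as (a2 & b2 & A2 & B2 & E2).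
destruct (Hp 3%nat ltac:(lia)) as (a3 & b3 & A3 & B3 & E3).
destruct (Hp 4%nat ltac:(lia)) as (a4 & b4 & A4 & B4 & E4).
destruct (Hp 5%nat ltac:(lia)) as (a5 & b5 & A5 & B5 & E5).
destruct (Hp 6%nat ltac:(lia)) as (a6 & b6 & A6 & B6 & E6).
assert (F1 : l1 = psum (fun r => nth r [a0; a1; a2; a3; a4; a5; a6] (RtoC 0)) 7).
{ apply (clim_psum7 _ _ _ H1); intros r Hr.
  do 7 (destruct r as [|r]; [match goal with A : clim _ ?x |- clim _ (nth _ _ _) =>
    refine (clim_ext _ _ _ _ A); intros n; apply psum_ext; intros i _;
    f_equal; lia end|]); lia. }
(* The list is reversed: [- (7 m + i + 1) = 7 (- (m + 1)) + (6 - i)], so position [i] of the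
   negative half lies in the class [6 - i]. *)
assert (F2 : l2 = psum (fun r => nth r [b6; b5; b4; b3; b2; b1; b0] (RtoC 0)) 7).
{ apply (clim_psum7 _ _ _ H2); intros r Hr.
  do 7 (destruct r as [|r]; [match goal with A : clim _ ?x |- clim _ (nth _ _ _) =>
    refine (clim_ext _ _ _ _ A); intros n; apply psum_ext; intros i _;
    f_equal; lia end|]); lia. }
simpl in *; rewrite F1, F2, E0, E1, E2, E3, E4, E5, E6; ring.
Qed.

(** The common summability criterion. Strict positivity of [r] allows division by its powers when
    the index is shifted. *)
Definition zgeom (f : Z -> C) : Prop :=
  exists M r, (0 < r < 1)%R /\ (0 <= M)%R /\
  forall k, (Cmod (f k) <= M * r ^ Z.abs_nat k)%R.

Lemma zgeom_zlim (f : Z -> C) : zgeom f -> zlim f (ZSeries f).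
Proof.
intros (M & r & Hr & HM & H).
destruct (psum_geom_cv (fun n => f (Z.of_nat n)) M r) as [l1 H1].
- lra.
- intros n; eapply Rle_trans; [apply H|]. rewrite Zabs2Nat.id; lra.
- destruct (psum_geom_cv (fun n => f (- Z.of_nat (S n))%Z) M r) as [l2 H2].
  + lra.
  + intros n; eapply Rle_trans; [apply H|].
    replace (Z.abs_nat (- Z.of_nat (S n))) with (S n) by lia.
    pose proof (pow_le r n ltac:(lra)); simpl.
    apply Rmult_le_compat_l; [lra|nra].
  + assert (Z0 : zlim f (l1 + l2)) by (exists l1, l2; auto).
    now rewrite (zlim_ZSeries _ _ Z0).
Qed.

Lemma pow_antitone (r : R) (n m : nat) :
  (0 < r < 1)%R -> (n <= m)%nat -> (r ^ m <= r ^ n)%R.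
Proof.
intros Hr Hnm; replace m with (n + (m - n))%nat by lia; rewrite pow_add.
pose proof (pow_lt r n ltac:(lra)).
assert (r ^ (m - n) <= 1)%R; [|nra].
rewrite <- (pow1 (m - n)); apply pow_incr; lra.
Qed.

(** Since [a >= 1], [|k| <= |a k + b| + |b|]; the loss [|b|] goes into the constant. *)
Lemma zgeom_affine (f : Z -> C) (a b : Z) :
  (1 <= a)%Z -> zgeom f -> zgeom (fun m => f (a * m + b)%Z).
Proof.
intros Ha (M & r & Hr & HM & H).
pose proof (pow_lt r (Z.abs_nat b) ltac:(lra)) as Hb.
exists (M / r ^ Z.abs_nat b)%R, r; split; [exact Hr|].
split; [apply Rdiv_le_0_compat; lra|].
intros k; eapply Rle_trans; [apply H|].
unfold Rdiv; rewrite Rmult_assoc; apply Rmult_le_compat_l; [lra|].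
apply (Rmult_le_reg_l (r ^ Z.abs_nat b)); [exact Hb|].
rewrite <- Rmult_assoc, Rinv_r, Rmult_1_l by lra.
rewrite <- pow_add; apply pow_antitone; [exact Hr|nia].
Qed.

Lemma zgeom_scal (c : C) (f g : Z -> C) :
  (forall m, g m = c * f m) -> zgeom f -> zgeom g.
Proof.
intros E (M & r & Hr & HM & H); pose proof (Cmod_ge_0 c).
exists (Cmod c * M)%R, r; split; [exact Hr|]; split; [nra|].
intros k; rewrite E, Cmod_mult, Rmult_assoc.
apply Rmult_le_compat_l; [lra|apply H].
Qed.

(** A residue class [f] of a known series is a monomial in [q] times a series [g] in [q ^ 7]; as [c]
    is invertible, [g] inherits its bound from [f] and needs no estimate of its own. *)
Lemma ZSeries_scal_of (c : C) (f g : Z -> C) :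
  c <> 0 -> zgeom f -> (forall m, f m = c * g m) ->
  zgeom g /\ ZSeries f = c * ZSeries g.
Proof.
intros Hc Hf E.
assert (Hg : zgeom g).
{ apply (zgeom_scal (/ c) f); [|exact Hf].
  intros m; rewrite E; field; exact Hc. }
split; [exact Hg|].
apply zlim_ZSeries, (zlim_ext (fun m => c * g m)); [intros; now rewrite E|].
apply zlim_scal, zgeom_zlim, Hg.
Qed.

Lemma ZSeries_shift3 (f : Z -> C) : zgeom f -> zlim (fun k => f (k - 3)%Z) (ZSeries f).
Proof.
intros H%zgeom_zlim; do 3 apply zlim_shift in H.
eapply zlim_ext; [|exact H]; intros m; cbv beta; f_equal; lia.
Qed.

Lemma ZSeries_dissect7 (f : Z -> C) :
  zgeom f ->
  ZSeries f = ZSeries (fun m => f (7 * m - 3)%Z) + ZSeries (fun m => f (7 * m - 2)%Z)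
    + ZSeries (fun m => f (7 * m - 1)%Z) + ZSeries (fun m => f (7 * m)%Z)
    + ZSeries (fun m => f (7 * m + 1)%Z) + ZSeries (fun m => f (7 * m + 2)%Z)
    + ZSeries (fun m => f (7 * m + 3)%Z).
Proof.
intros Hf.
(* Shifting the index by 3 beforehand turns the residues 0 to 6 into the centred ones, -3 to 3. *)
rewrite (zlim7 _ _ (fun r => nth r
  [ZSeries (fun m => f (7 * m - 3)%Z); ZSeries (fun m => f (7 * m - 2)%Z);
   ZSeries (fun m => f (7 * m - 1)%Z); ZSeries (fun m => f (7 * m)%Z);
   ZSeries (fun m => f (7 * m + 1)%Z); ZSeries (fun m => f (7 * m + 2)%Z);
   ZSeries (fun m => f (7 * m + 3)%Z)] (RtoC 0)) (ZSeries_shift3 f Hf)).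
- simpl; ring.
- intros r Hr.
  assert (K : forall c g, (forall m, f (7 * m + c)%Z = g m) -> zlim g (ZSeries g)).
  { intros c g E; pose proof (zgeom_zlim _ (zgeom_affine f 7 c ltac:(lia) Hf)) as H.
    pose proof (zlim_ext _ _ _ E H) as H'; now rewrite (zlim_ZSeries _ _ H'). }
  assert (K' : forall c i g, (forall m, f (7 * m + c)%Z = g m) ->
    (c = Z.of_nat i - 3)%Z ->
    zlim (fun m => f (7 * m + Z.of_nat i - 3)%Z) (ZSeries g)).
  { intros c i g E Hi; apply (zlim_ext g); [|exact (K c g E)].
    intros m; rewrite <- E; f_equal; lia. }
  destruct r as [|[|[|[|[|[|[|r]]]]]]]; [..|lia]; cbv [nth].
  + apply (K' (-3)%Z); [intros; f_equal; lia|reflexivity].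
  + apply (K' (-2)%Z); [intros; f_equal; lia|reflexivity].
  + apply (K' (-1)%Z); [intros; f_equal; lia|reflexivity].
  + apply (K' 0%Z); [intros; f_equal; lia|reflexivity].
  + apply (K' 1%Z); [intros; f_equal; lia|reflexivity].
  + apply (K' 2%Z); [intros; f_equal; lia|reflexivity].
  + apply (K' 3%Z); [intros; f_equal; lia|reflexivity].
Qed.

(** * Integer powers and infinite products *)

Lemma CpowZ_nat (x : C) (n : nat) : x ^^ (Z.of_nat n) = x ^ n.
Proof. destruct n as [|n]; [reflexivity|]; simpl CpowZ; now rewrite SuccNat2Pos.id_succ. Qed.

Lemma CpowZ_opp_nat (x : C) (n : nat) : x ^^ (- Z.of_nat n) = / x ^ n.
Proof.
destruct n as [|n]; [simpl; field|].
simpl CpowZ; now rewrite SuccNat2Pos.id_succ.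
Qed.

Lemma CpowZ_1 (x : C) : x ^^ 1 = x.
Proof. simpl; ring. Qed.

Lemma CpowZ_succ (x : C) (k : Z) : x <> 0 -> x ^^ (k + 1) = x ^^ k * x.
Proof.
intros Hx; destruct (Z_le_gt_dec 0 k) as [H|H].
- rewrite <- (Z2Nat.id k H); replace (Z.of_nat (Z.to_nat k) + 1)%Z
    with (Z.of_nat (S (Z.to_nat k))) by lia.
  rewrite !CpowZ_nat; simpl; ring.
- replace k with (- Z.of_nat (S (Z.to_nat (- k - 1))))%Z by lia.
  set (n := Z.to_nat (- k - 1)).
  replace (- Z.of_nat (S n) + 1)%Z with (- Z.of_nat n)%Z by lia.
  rewrite !CpowZ_opp_nat; simpl.
  pose proof (Cpow_nz x n Hx); field; auto.
Qed.

Lemma CpowZ_nz (x : C) (k : Z) : x <> 0 -> x ^^ k <> 0.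
Proof.
intros Hx; destruct k as [|p|p]; simpl.
- apply C1_nz.
- now apply Cpow_nz.
- intros H; apply (Cpow_nz x (Pos.to_nat p) Hx).
  assert (E : x ^ Pos.to_nat p * / x ^ Pos.to_nat p = 1) by (apply Cinv_r, Cpow_nz, Hx).
  rewrite H, Cmult_0_r in E; symmetry in E; apply RtoC_inj in E; lra.
Qed.

Lemma CpowZ_add (x : C) (j k : Z) : x <> 0 -> x ^^ (j + k) = x ^^ j * x ^^ k.
Proof.
intros Hx; revert k; apply Z.bi_induction.
- intros ? ? ->; reflexivity.
- rewrite Z.add_0_r; simpl; ring.
- intros k; split; intros H.
  + replace (j + Z.succ k)%Z with ((j + k) + 1)%Z by lia.
    unfold Z.succ; rewrite !CpowZ_succ, H by exact Hx; ring.
  + replace (j + Z.succ k)%Z with ((j + k) + 1)%Z in H by lia.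
    unfold Z.succ in H; rewrite !CpowZ_succ in H by exact Hx.
    apply (f_equal (fun t => t * / x)) in H.
    replace (x ^^ (j + k)) with (x ^^ (j + k) * x * / x) by (field; exact Hx).
    rewrite H; field; exact Hx.
Qed.

Lemma CpowZ_opp (x : C) (k : Z) : x <> 0 -> x ^^ (- k) = / x ^^ k.
Proof.
intros Hx.
assert (E : x ^^ (- k) * x ^^ k = 1).
{ rewrite <- CpowZ_add by exact Hx. now replace (- k + k)%Z with 0%Z by lia. }
pose proof (CpowZ_nz x k Hx).
replace (/ x ^^ k) with (x ^^ (- k) * x ^^ k * / x ^^ k) by (rewrite E; ring).
field; assumption.
Qed.

Lemma CpowZ_pow (x : C) (n : nat) (k : Z) :
  x <> 0 -> (x ^ n) ^^ k = x ^^ (Z.of_nat n * k).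
Proof.
intros Hx; pose proof (Cpow_nz x n Hx) as Hn; revert k; apply Z.bi_induction.
- intros ? ? ->; reflexivity.
- rewrite Z.mul_0_r; reflexivity.
- intros k. replace (Z.of_nat n * Z.succ k)%Z with (Z.of_nat n * k + Z.of_nat n)%Z by lia.
  unfold Z.succ; rewrite CpowZ_succ, CpowZ_add, CpowZ_nat by assumption.
  split; intros H; [now rewrite H|].
  apply (f_equal (fun t => t * / x ^ n)) in H.
  rewrite <- !Cmult_assoc, Cinv_r, !Cmult_1_r in H by exact Hn; exact H.
Qed.

Lemma Cmod_m1_CpowZ (k : Z) : Cmod ((-1) ^^ k) = 1%R.
Proof.
assert (H : forall n, Cmod ((-1) ^ n) = 1%R).
{ intros n; rewrite Cmod_pow, Cmod_R, Rabs_left by lra.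
  replace (- -1)%R with 1%R by lra; apply pow1. }
destruct k as [|p|p]; simpl CpowZ; [apply Cmod_1|apply H|].
rewrite Cmod_inv, H; [lra|].
apply Cmod_gt_0; rewrite H; lra.
Qed.

Lemma m1_neq_0 : RtoC (-1) <> 0.
Proof. intros H; apply RtoC_inj in H; lra. Qed.

Lemma m1_CpowZ_succ (k : Z) : (-1) ^^ (k + 1) = - (-1) ^^ k.
Proof. rewrite CpowZ_succ by apply m1_neq_0; change (RtoC (-1)) with (RtoC (- (1))).
rewrite RtoC_opp; ring. Qed.

Lemma m1_CpowZ_opp (k : Z) : (-1) ^^ (- k) = (-1) ^^ k.
Proof.
revert k; apply Z.bi_induction; [intros ? ? ->; reflexivity|reflexivity|].
intros k; replace (- k)%Z with (- Z.succ k + 1)%Z by lia.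
unfold Z.succ; rewrite !m1_CpowZ_succ; split; intros H.
- rewrite <- H; ring.
- rewrite H; ring.
Qed.

(** Used with the odd multiplier 7: each residue class modulo 7 still alternates in sign. *)
Lemma m1_CpowZ_odd_mul (a k : Z) : (-1) ^^ ((2 * a + 1) * k) = (-1) ^^ k.
Proof.
assert (E : forall j, (-1) ^^ (2 * j) = 1).
{ intros j; replace (2 * j)%Z with (j - - j)%Z by lia; unfold Z.sub.
  rewrite CpowZ_add, Z.opp_involutive by apply m1_neq_0.
  rewrite <- (m1_CpowZ_opp j) at 1; rewrite <- CpowZ_add by apply m1_neq_0.
  now replace (- j + j)%Z with 0%Z by lia. }
replace ((2 * a + 1) * k)%Z with (2 * (a * k) + k)%Z by lia.
rewrite CpowZ_add, E by apply m1_neq_0; ring.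
Qed.

(** * Size estimates for terms of q-series *)

Lemma Cmod_lt_1_pow_neq_1 (q : C) (n : nat) : (Cmod q < 1)%R -> 1 - q ^ S n <> 0.
Proof.
intros Hq H.
assert (E : q ^ S n = 1) by (replace (q ^ S n) with (1 - (1 - q ^ S n)) by ring;
  rewrite H; ring).
apply (f_equal Cmod) in E; rewrite Cmod_pow, Cmod_1 in E.
pose proof (Cmod_ge_0 q); pose proof (pow_incr (Cmod q) 1 n ltac:(lra)) as K.
rewrite pow1 in K; pose proof (pow_le (Cmod q) n ltac:(lra)); simpl in E; nra.
Qed.

Lemma Cmod_CpowZ_le (q : C) (n : nat) (c k : Z) :
  (0 < Cmod q < 1)%R -> (Z.of_nat n - c <= k)%Z ->
  (Cmod (q ^^ k) <= Cmod (q ^^ (- c)) * Cmod q ^ n)%R.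
Proof.
intros Hq Hk.
assert (Hq0 : q <> 0) by (apply Cmod_gt_0; lra).
replace k with (- c + Z.of_nat n + Z.of_nat (Z.to_nat (k - (Z.of_nat n - c))))%Z by lia.
rewrite !CpowZ_add, !CpowZ_nat, !Cmod_mult, !Cmod_pow by exact Hq0.
set (j := Z.to_nat _).
pose proof (pow_incr (Cmod q) 1 j ltac:(lra)) as K; rewrite pow1 in K.
pose proof (Cmod_ge_0 (q ^^ (- c))); pose proof (pow_le (Cmod q) n ltac:(lra)).
pose proof (Rmult_le_pos _ _ H H0); nra.
Qed.

(** Linear growth of the exponent already gives geometric decay, so a crude slack [c] replaces any
    analysis of the quadratic form. *)
Lemma zgeom_quadratic (q : C) (s : Z -> C) (e : Z -> Z) (B : R) (c : Z) :
  (0 < Cmod q < 1)%R -> (forall m, (Cmod (s m) <= B)%R) ->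
  (forall m, (Z.abs m - c <= e m)%Z) ->
  zgeom (fun m => s m * q ^^ (e m)).
Proof.
intros Hq Hs He.
assert (HB : (0 <= B)%R) by (eapply Rle_trans; [apply Cmod_ge_0|apply (Hs 0%Z)]).
exists (B * Cmod (q ^^ (- c)))%R, (Cmod q).
pose proof (Cmod_ge_0 (q ^^ (- c))).
split; [exact Hq|]; split; [nra|].
intros k; rewrite Cmod_mult, Rmult_assoc.
apply Rmult_le_compat; try apply Cmod_ge_0; [apply Hs|].
apply Cmod_CpowZ_le; [exact Hq|]; specialize (He k); lia.
Qed.

Lemma zgeom_plus (f g : Z -> C) :
  zgeom f -> zgeom g -> zgeom (fun m => f m + g m).
Proof.
intros (M & r & Hr & HM & H) (M' & r' & Hr' & HM' & H').
exists (M + M')%R, (Rmax r r').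
assert (0 < Rmax r r' < 1)%R by (apply Rmax_case; lra).
split; [assumption|]; split; [lra|].
intros k; eapply Rle_trans; [apply Cmod_triangle|].
specialize (H k); specialize (H' k).
pose proof (pow_incr r (Rmax r r') (Z.abs_nat k)
  (conj (Rlt_le _ _ (proj1 Hr)) (Rmax_l r r'))).
pose proof (pow_incr r' (Rmax r r') (Z.abs_nat k)
  (conj (Rlt_le _ _ (proj1 Hr')) (Rmax_r r r'))).
nra.
Qed.

(** This default value makes a term with denominator [1 - q ^^ 0] vanish, so sums over nonzero
    integers can be treated as sums over all integers. *)
Lemma Cinv_0 : / 0 = 0.
Proof. unfold Cinv, RtoC; simpl; f_equal; unfold Rdiv; ring. Qed.

(** Negative exponents reduce to positive ones by [1 / (1 - 1/x) = - x / (1 - x)]; at [k = 0] the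
    bound rests on the default value of the inverse. *)
Lemma Cmod_inv_1_minus_le (q : C) (k : Z) :
  (0 < Cmod q < 1)%R -> (Cmod (/ (1 - q ^^ k)) <= / (1 - Cmod q))%R.
Proof.
intros Hq.
assert (Hq0 : q <> 0) by (apply Cmod_gt_0; lra).
assert (Hpos : forall n, (1 - Cmod q <= Cmod (1 - q ^ S n))%R).
{ intros n; pose proof (Cmod_triangle (1 - q ^ S n) (q ^ S n)) as K.
  replace (1 - q ^ S n + q ^ S n) with (RtoC 1) in K by ring.
  rewrite Cmod_1, Cmod_pow in K.
  pose proof (pow_antitone (Cmod q) 1 (S n) Hq ltac:(lia)); rewrite pow_1 in *; lra. }
destruct (Z.lt_total k 0) as [H|[->|H]].
- replace k with (- Z.of_nat (S (Z.to_nat (- k - 1))))%Z by lia.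
  rewrite CpowZ_opp_nat; set (n := Z.to_nat _); specialize (Hpos n).
  pose proof (Cpow_nz q (S n) Hq0) as Hn.
  pose proof (Cmod_lt_1_pow_neq_1 q n (proj2 Hq)) as Hn'.
  replace (/ (1 - / q ^ S n)) with (- (q ^ S n * / (1 - q ^ S n))).
  2:{ field; repeat split; auto. intros E; apply Hn'.
      replace (1 - q ^ S n) with (- (q ^ S n - 1)) by ring; rewrite E; ring. }
  rewrite Cmod_opp, Cmod_mult, Cmod_inv, Cmod_pow by exact Hn'.
  apply Rle_trans with (1 * / Cmod (1 - q ^ S n))%R.
  + apply Rmult_le_compat_r; [left; apply Rinv_0_lt_compat; lra|].
    rewrite <- (pow1 (S n)); apply pow_incr; lra.
  + rewrite Rmult_1_l; apply Rinv_le_contravar; lra.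
- simpl; replace (1 - 1) with (RtoC 0) by ring.
  rewrite Cinv_0, Cmod_0; left; apply Rinv_0_lt_compat; lra.
- replace k with (Z.of_nat (S (Z.to_nat (k - 1)))) by lia.
  rewrite CpowZ_nat; set (n := Z.to_nat _); specialize (Hpos n).
  rewrite Cmod_inv by (apply Cmod_lt_1_pow_neq_1; lra).
  apply Rinv_le_contravar; lra.
Qed.

(** * Convergence and non-vanishing of infinite products *)

Lemma Cprod_ext (a b : nat -> C) (n : nat) :
  (forall i, a i = b i) -> Cprod a n = Cprod b n.
Proof. intros E; induction n as [|n IH]; simpl; [|rewrite IH, E]; reflexivity. Qed.

Lemma Cprod_geom_bound (y : nat -> C) (K r : R) (n : nat) :
  (0 <= r < 1)%R -> (0 <= K)%R -> (forall m, (Cmod (y m) <= K * r ^ m)%R) ->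
  (Cmod (Cprod (fun m => 1 + y m)%C n) <= exp (K / (1 - r)))%R.
Proof.
intros Hr HK Hy.
(* The induction multiplies bounds by [1 + t <= exp t], so the exponent must be the finite geometric
   sum. *)
apply Rle_trans with (exp (K * (1 - r ^ n) / (1 - r))).
- induction n as [|n IH]; simpl Cprod.
  + rewrite Cmod_1; simpl; right.
    replace (K * (1 - 1) / (1 - r))%R with 0%R by (field; lra). now rewrite exp_0.
  + rewrite Cmod_mult.
    replace (K * (1 - r ^ S n) / (1 - r))%R
      with (K * (1 - r ^ n) / (1 - r) + K * r ^ n)%R by (simpl; field; lra).
    rewrite exp_plus; apply Rmult_le_compat; try apply Cmod_ge_0; [exact IH|].
    eapply Rle_trans; [apply Cmod_triangle|]; rewrite Cmod_1.
    eapply Rle_trans; [apply Rplus_le_compat_l, Hy|].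
    apply exp_ineq1_le.
- apply Rnot_lt_le; intros H%exp_lt_inv; revert H; apply Rle_not_lt.
  apply Rmult_le_compat_r; [left; apply Rinv_0_lt_compat; lra|].
  pose proof (pow_le r n ltac:(lra)); nra.
Qed.

(** The partial products [P] satisfy [P (n + 1) - P n = P n * y n]; boundedness of [P] makes the
    series of these increments geometric. *)
Lemma Cprod_geom_cv (y : nat -> C) (K r : R) :
  (0 <= r < 1)%R -> (0 <= K)%R -> (forall m, (Cmod (y m) <= K * r ^ m)%R) ->
  exists l, clim (Cprod (fun m => 1 + y m)) l.
Proof.
intros Hr HK Hy; set (P := Cprod (fun m => 1 + y m)).
destruct (psum_geom_cv (fun n => P n * y n) (exp (K / (1 - r)) * K) r Hr) as [l Hl].
- intros n; rewrite Cmod_mult, Rmult_assoc.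
  apply Rmult_le_compat; try apply Cmod_ge_0; [|apply Hy].
  apply Cprod_geom_bound; assumption.
- exists (1 + l).
  apply (clim_ext (fun n => 1 + psum (fun n => P n * y n) n)).
  + intros n; unfold P; induction n as [|n IH]; simpl; [ring|].
    rewrite <- IH; ring.
  + apply clim_plus; [apply clim_const|exact Hl].
Qed.

Definition qfin (A q : C) : nat -> C := Cprod (fun m => 1 - A * q ^ m).

Lemma qfin_cv (A q : C) : (Cmod q < 1)%R -> clim (qfin A q) (qpoch A q).
Proof.
intros Hq; pose proof (Cmod_ge_0 q).
destruct (Cprod_geom_cv (fun m => - (A * q ^ m)) (Cmod A) (Cmod q)) as [l Hl].
- lra.
- apply Cmod_ge_0.
- intros m; rewrite Cmod_opp, Cmod_mult, Cmod_pow; lra.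
- assert (E : clim (qfin A q) l).
  { eapply clim_ext; [|exact Hl]; intros n; apply Cprod_ext; intros; ring. }
  assert (E' : qpoch A q = l).
  { apply Clim_seq_unique, clim_filterlim, E. }
  now rewrite E'.
Qed.

Lemma Cmod_qfactor_ge (A q : C) (m : nat) :
  (Cmod q < 1)%R -> (Cmod A < 1)%R -> (1 - Cmod A <= Cmod (1 - A * q ^ m))%R.
Proof.
intros Hq HA; pose proof (Cmod_triangle (1 - A * q ^ m) (A * q ^ m)) as K.
replace (1 - A * q ^ m + A * q ^ m) with (RtoC 1) in K by ring.
rewrite Cmod_1, Cmod_mult, Cmod_pow in K.
pose proof (Cmod_ge_0 A); pose proof (Cmod_ge_0 q).
pose proof (pow_incr (Cmod q) 1 m ltac:(lra)) as K2; rewrite pow1 in K2; nra.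
Qed.

Lemma qfin_neq_0 (A q : C) (n : nat) :
  (Cmod q < 1)%R -> (Cmod A < 1)%R -> qfin A q n <> 0.
Proof.
intros Hq HA; unfold qfin; induction n as [|n IH]; simpl.
- apply C1_nz.
- apply Cmult_neq_0; [exact IH|].
  apply Cmod_gt_0; pose proof (Cmod_qfactor_ge A q n Hq HA); lra.
Qed.

(* The reciprocals are again partial products with factors geometrically close
   to 1, so they converge too, which forces a nonzero limit. *)
Lemma qpoch_neq_0 (A q : C) :
  (Cmod q < 1)%R -> (Cmod A < 1)%R ->
  qpoch A q <> 0 /\ clim (fun n => / qfin A q n) (/ qpoch A q).
Proof.
intros Hq HA; pose proof (Cmod_ge_0 q); pose proof (Cmod_ge_0 A).
assert (Hf : forall m, 1 - A * q ^ m <> 0).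
{ intros m; apply Cmod_gt_0; pose proof (Cmod_qfactor_ge A q m Hq HA); lra. }
destruct (Cprod_geom_cv (fun m => A * q ^ m / (1 - A * q ^ m))
            (Cmod A / (1 - Cmod A)) (Cmod q)) as [l Hl].
- lra.
- apply Rdiv_le_0_compat; lra.
- intros m; rewrite Cmod_div, Cmod_mult, Cmod_pow by apply Hf.
  unfold Rdiv; rewrite !Rmult_assoc, (Rmult_comm (/ _) (_ ^ _)).
  apply Rmult_le_compat_l; [lra|]; apply Rmult_le_compat_l; [apply pow_le; lra|].
  apply Rinv_le_contravar; [lra|apply Cmod_qfactor_ge; assumption].
- assert (E : clim (fun n => / qfin A q n) l).
  { eapply clim_ext; [|exact Hl]; intros n.
    induction n as [|n IH]; unfold qfin in *; simpl.
    - field.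
    - rewrite IH; field; split; [apply Hf|apply (qfin_neq_0 A q n); assumption]. }
  assert (E1 : qpoch A q * l = 1).
  { apply (clim_unique (fun n => qfin A q n * / qfin A q n)).
    - apply clim_mult; [apply qfin_cv; exact Hq|exact E].
    - eapply clim_ext; [|apply clim_const].
      intros n; symmetry; apply Cinv_r, qfin_neq_0; assumption. }
  assert (E0 : qpoch A q <> 0).
  { intros Z0; rewrite Z0, Cmult_0_l in E1; apply RtoC_inj in E1; lra. }
  split; [exact E0|].
  replace (/ qpoch A q) with l; [exact E|].
  replace l with (qpoch A q * l * / qpoch A q) by (field; exact E0).
  rewrite E1; ring.
Qed.

Lemma qpoch_head (A q : C) : (Cmod q < 1)%R -> qpoch A q = (1 - A) * qpoch (A * q) q.
Proof.
intros Hq; apply (clim_unique (fun n => qfin A q (S n))).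
- apply (clim_sub _ _ S); [intros; lia|now apply qfin_cv].
- apply (clim_ext (fun n => (1 - A) * qfin (A * q) q n)).
  + intros n; unfold qfin; induction n as [|n IH]; simpl; [ring|].
    simpl in IH; rewrite Cmult_assoc, IH; ring.
  + apply clim_scal, qfin_cv, Hq.
Qed.

(** * The quintuple product identity *)

(** The value 0 at negative indices follows the convention [1 / (q;q)_j = 0] and truncates bilateral
    sums to finite support. *)
Definition qfin_inv (A q : C) (j : Z) : C :=
  if (0 <=? j)%Z then / qfin A q (Z.to_nat j) else 0.

Lemma qfin_inv_cv (A q : C) (j : Z) :
  (Cmod q < 1)%R -> (Cmod A < 1)%R ->
  clim (fun n => qfin_inv A q (Z.of_nat n + j)) (/ qpoch A q).
Proof.
intros Hq HA eps Heps.
destruct (proj2 (qpoch_neq_0 A q Hq HA) eps Heps) as [N HN].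
exists (N + Z.abs_nat j)%nat; intros n Hn; unfold qfin_inv.
destruct (Z.leb_spec 0 (Z.of_nat n + j)) as [H|H]; [|lia].
apply HN; lia.
Qed.

Lemma qfin_inv_bounded (A q : C) :
  (Cmod q < 1)%R -> (Cmod A < 1)%R ->
  exists B, (0 < B)%R /\ forall j, (Cmod (qfin_inv A q j) <= B)%R.
Proof.
intros Hq HA.
destruct (clim_bounded _ _ (proj2 (qpoch_neq_0 A q Hq HA))) as [B [HB H]].
exists B; split; [exact HB|]; intros j; unfold qfin_inv.
destruct (0 <=? j)%Z; [apply H|rewrite Cmod_0; lra].
Qed.

(* The vanishing of [1 - q ^^ 0] makes the recurrence hold across [j = 0]. *)
Definition qq_inv (c q : C) (j : Z) : C := qfin_inv q q j * qfin_inv (c * q) q j.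

Lemma qq_inv_pred (c q : C) (j : Z) :
  (0 < Cmod q < 1)%R -> (Cmod (c * q) < 1)%R ->
  qq_inv c q (j - 1) = (1 - q ^^ j) * (1 - c * q ^^ j) * qq_inv c q j.
Proof.
intros Hq Hc; unfold qq_inv, qfin_inv.
destruct (Z.lt_total j 0) as [H|[->|H]].
- destruct (Z.leb_spec 0 (j - 1)); destruct (Z.leb_spec 0 j); try lia; ring.
- simpl; ring.
- destruct (Z.leb_spec 0 (j - 1)); destruct (Z.leb_spec 0 j); try lia.
  replace j with (Z.of_nat (S (Z.to_nat (j - 1)))) by lia.
  set (n := Z.to_nat (j - 1)).
  replace (Z.of_nat (S n) - 1)%Z with (Z.of_nat n) by lia.
  rewrite !Nat2Z.id, CpowZ_nat.
  pose proof (qfin_neq_0 q q n ltac:(lra) ltac:(lra)) as K1.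
  pose proof (qfin_neq_0 (c * q) q n ltac:(lra) Hc) as K2.
  pose proof (qfin_neq_0 q q (S n) ltac:(lra) ltac:(lra)) as K3.
  pose proof (qfin_neq_0 (c * q) q (S n) ltac:(lra) Hc) as K4.
  unfold qfin in *; simpl in *.
  field; repeat split; auto.
  + intros E; apply K4; rewrite E; ring.
  + intros E; apply K3; rewrite E; ring.
Qed.

(** * A finite form of the quintuple product *)

Definition theta5 (z q : C) (k : Z) : C :=
  (-1) ^^ k * z ^^ (3 * k) * q ^^ (k * (3 * k - 1) / 2).

Lemma theta5_succ (z q : C) (k : Z) :
  z <> 0 -> q <> 0 ->
  theta5 z q (k + 1) = - z ^ 3 * q * (q ^^ k) ^ 3 * theta5 z q k.
Proof.
intros Hz Hq; unfold theta5; rewrite m1_CpowZ_succ.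
replace ((k + 1) * (3 * (k + 1) - 1))%Z
  with (k * (3 * k - 1) + (1 + (k + (k + k))) * 2)%Z by ring.
rewrite Z.div_add by lia.
replace (3 * (k + 1))%Z with (3 * k + Z.of_nat 3)%Z by lia.
rewrite !CpowZ_add, CpowZ_nat, CpowZ_1 by assumption; ring.
Qed.

Definition wz_weight (z q : C) (n : nat) : C :=
  qfin q q (2 * n) * qfin (/ z * q) q n * qfin (z * q) q n.

(** A centred version of the finite quintuple sum, over [j] from 0 to [N], of [(1 + z q^j)
    [N choose j]_q (z;q)_(N+1) / (z^2 q^j;q)_(N+1) z^j q^(j^2)]: put [N = 2 n], [j = n + k], replace
    [z] by [z q^(-n)] and multiply by [1 + z]. Centring makes each term converge as [n] grows. *)
Definition wz_term (z q : C) (n : nat) (k : Z) : C :=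
  (1 + z * q ^^ k) * theta5 z q k *
  (wz_weight z q n * qq_inv (/ z ^ 2) q (Z.of_nat n - k)
     * qq_inv (z ^ 2) q (Z.of_nat n + k)).

(* The Laurent polynomial in [y = q ^^ k] was found by solving
   [wz_term_telescopes] for it. *)
Definition wz_cert (z q : C) (n : nat) (k : Z) : C :=
  let x := q ^ n in let y := q ^^ k in
  theta5 z q k * wz_weight z q n *
  (q * x ^ 2 * (1 + q / (z * y) ^ 2 + q * (1 - q * x ^ 2) / (z * y))
     - q * x * (1 + / z ^ 2) / y) *
  qq_inv (/ z ^ 2) q (Z.of_nat n + 1 - k) * qq_inv (z ^ 2) q (Z.of_nat n + k).

(** The recurrence for [qq_inv] brings every reciprocal factor to the indices [n + 1 - k] and
    [n + 1 + k]. What remains, after the common factors, is a rational identity in [q], [z],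
    [x = q ^ n] and [y = q ^^ k]. *)
Lemma wz_term_telescopes (z q : C) (n : nat) (k : Z) :
  (0 < Cmod q < 1)%R -> z <> 0 ->
  (Cmod (z ^ 2 * q) < 1)%R -> (Cmod (/ z ^ 2 * q) < 1)%R ->
  wz_term z q (S n) k - wz_term z q n k = wz_cert z q n (k + 1) - wz_cert z q n k.
Proof.
intros Hq Hz H1 H2; assert (Hq0 : q <> 0) by (apply Cmod_gt_0; lra).
unfold wz_term, wz_cert; cbv zeta.
rewrite theta5_succ, (CpowZ_succ q k) by assumption.
replace (Z.of_nat (S n) - k)%Z with (Z.of_nat n + 1 - k)%Z by lia.
replace (Z.of_nat (S n) + k)%Z with (Z.of_nat n + 1 + k)%Z by lia.
replace (Z.of_nat n + (k + 1))%Z with (Z.of_nat n + 1 + k)%Z by lia.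
replace (Z.of_nat n + 1 - (k + 1))%Z with (Z.of_nat n - k)%Z by lia.
replace (Z.of_nat n - k)%Z with (Z.of_nat n + 1 - k - 1)%Z by lia.
replace (Z.of_nat n + k)%Z with (Z.of_nat n + 1 + k - 1)%Z by lia.
rewrite !qq_inv_pred by assumption.
set (U := qq_inv _ q _); set (V := qq_inv _ q _).
assert (W : wz_weight z q (S n) = wz_weight z q n *
  ((1 - q * (q ^ n) ^ 2) * (1 - q ^ 2 * (q ^ n) ^ 2) *
   (1 - / z * q * q ^ n) * (1 - z * q * q ^ n))).
{ unfold wz_weight, qfin; replace (2 * S n)%nat with (S (S (2 * n))) by lia.
  simpl Cprod; replace (n + (n + 0))%nat with (n + n)%nat by lia.
  simpl; rewrite Cpow_add_r; ring. }
rewrite W.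
unfold Z.sub; rewrite !CpowZ_add, CpowZ_opp, CpowZ_1, CpowZ_nat by assumption.
pose proof (CpowZ_nz q k Hq0) as Hy.
set (y := q ^^ k) in *; set (x := q ^ n); set (T := theta5 z q k).
set (w := wz_weight z q n).
field; auto.
Qed.

(** Pairing [k] with [- k] makes a bilateral sum one-sided, the form to which telescoping and
    [tannery] apply. *)
Definition symterm (f : Z -> C) (i : nat) : C :=
  match i with
  | O => f 0%Z
  | S _ => f (Z.of_nat i) + f (- Z.of_nat i)%Z
  end.

Lemma psum_symterm_telescope (g : Z -> C) (n : nat) :
  psum (symterm (fun k => g (k + 1)%Z - g k)) (S n)
  = g (Z.of_nat n + 1)%Z - g (- Z.of_nat n)%Z.
Proof.
induction n as [|n IH].
- simpl; ring.
- change (psum (symterm (fun k => g (k + 1)%Z - g k)) (S (S n)))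
    with (psum (symterm (fun k => g (k + 1)%Z - g k)) (S n)
          + symterm (fun k => g (k + 1)%Z - g k) (S n)).
  rewrite IH; unfold symterm.
  replace (- Z.of_nat (S n) + 1)%Z with (- Z.of_nat n)%Z by lia.
  replace (Z.of_nat n + 1)%Z with (Z.of_nat (S n)) by lia; ring.
Qed.

Lemma qq_inv_neg (c q : C) (j : Z) : (j < 0)%Z -> qq_inv c q j = 0.
Proof.
intros H; unfold qq_inv, qfin_inv.
destruct (Z.leb_spec 0 j); [lia|ring].
Qed.

(** Induction on [n] with the cutoff [N] fixed. Each step adds a telescoping sum whose two boundary
    values contain a reciprocal factor of index [n - N < 0], hence vanish; at [n = 0] only [k = 0]
    contributes. *)
Lemma finite_quintuple (z q : C) (n N : nat) :
  (0 < Cmod q < 1)%R -> z <> 0 ->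
  (Cmod (z ^ 2 * q) < 1)%R -> (Cmod (/ z ^ 2 * q) < 1)%R ->
  (n <= N)%nat -> psum (symterm (wz_term z q n)) (S N) = 1 + z.
Proof.
intros Hq Hz H1 H2; induction n as [|n IH]; intros Hn.
- rewrite psum_S_l, psum_eq_0.
  + unfold symterm, wz_term, wz_weight, theta5, qq_inv, qfin_inv, qfin; simpl.
    field; assumption.
  + intros i; unfold symterm, wz_term.
    rewrite (qq_inv_neg _ _ (Z.of_nat 0 - Z.of_nat (S i))),
      (qq_inv_neg _ _ (Z.of_nat 0 + - Z.of_nat (S i))) by lia; ring.
- rewrite <- (IH ltac:(lia)).
  assert (E : psum (symterm (wz_term z q (S n))) (S N)
    = psum (symterm (wz_term z q n)) (S N)
      + psum (symterm (fun k => wz_cert z q n (k + 1) - wz_cert z q n k)) (S N)).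
  { rewrite <- psum_plus; apply psum_ext; intros [|i] _; unfold symterm;
      rewrite <- !wz_term_telescopes by assumption; ring. }
  rewrite E, psum_symterm_telescope; unfold wz_cert; cbv zeta.
  rewrite (qq_inv_neg _ _ (Z.of_nat n + 1 - (Z.of_nat N + 1))),
    (qq_inv_neg _ _ (Z.of_nat n + - Z.of_nat N)) by lia; ring.
Qed.

(** * Passage to the limit in the finite identity *)

Lemma Cmod_mult_le (a b : C) (A B : R) :
  (Cmod a <= A)%R -> (Cmod b <= B)%R -> (Cmod (a * b) <= A * B)%R.
Proof.
intros Ha Hb; rewrite Cmod_mult.
apply Rmult_le_compat; auto using Cmod_ge_0.
Qed.

Lemma clim_psum_symterm (f : Z -> C) (l : C) :
  zlim f l -> clim (psum (symterm f)) l.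
Proof.
intros (l1 & l2 & H1 & H2 & ->); apply clim_incr.
apply (clim_ext (fun n => psum (fun i => f (Z.of_nat i)) (S n)
                  + psum (fun i => f (- Z.of_nat (S i))%Z) n)).
- induction n as [|n IH].
  + simpl; ring.
  + change (psum (symterm f) (S (S n)))
      with (psum (symterm f) (S n) + symterm f (S n)).
    rewrite <- IH; unfold symterm.
    cbn [psum]; ring.
- apply clim_plus; [|exact H2].
  apply (clim_sub _ _ S); [intros; lia|exact H1].
Qed.

Lemma quintuple_product (z q : C) :
  (0 < Cmod q < 1)%R -> z <> 0 ->
  (Cmod (z * q) < 1)%R -> (Cmod (/ z * q) < 1)%R ->
  (Cmod (z ^ 2 * q) < 1)%R -> (Cmod (/ z ^ 2 * q) < 1)%R ->
  zgeom (fun k => (1 + z * q ^^ k) * theta5 z q k) ->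
  ZSeries (fun k => (1 + z * q ^^ k) * theta5 z q k)
    * (qpoch (z * q) q * qpoch (/ z * q) q)
  = (1 + z) * (qpoch q q * qpoch (z ^ 2 * q) q * qpoch (/ z ^ 2 * q) q).
Proof.
intros Hq Hz H1 H2 H3 H4 Hg; assert (Hq1 : (Cmod q < 1)%R) by lra.
set (g := fun k => (1 + z * q ^^ k) * theta5 z q k) in *.
destruct (qpoch_neq_0 q q Hq1 Hq1) as [N0 _].
destruct (qpoch_neq_0 _ q Hq1 H3) as [N3 _].
destruct (qpoch_neq_0 _ q Hq1 H4) as [N4 _].
(* [w] is the limit of the [k]-th weight, independent of [k]; it factors out of the limiting sum. *)
set (w := qpoch q q * qpoch (/ z * q) q * qpoch (z * q) q
  * (/ qpoch q q * / qpoch (/ z ^ 2 * q) q)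
  * (/ qpoch q q * / qpoch (z ^ 2 * q) q)).
assert (Hlim : forall k, clim (fun n => wz_term z q n k) (g k * w)).
{ intros k; unfold wz_term, qq_inv, wz_weight, w.
  apply clim_scal; repeat apply clim_mult;
    try (apply qfin_cv; exact Hq1);
    try (apply (qfin_inv_cv _ q k); assumption);
    try (apply (qfin_inv_cv _ q (- k)); assumption).
  apply (clim_sub (qfin q q) _ (fun n => 2 * n)%nat); [intros; lia|].
  apply qfin_cv, Hq1. }
assert (Hbd : exists B, (0 <= B)%R /\
  forall n k, (Cmod (wz_term z q n k) <= Cmod (g k) * B)%R).
{ destruct (clim_bounded _ _ (qfin_cv q q Hq1)) as [b1 [P1 B1]].
  destruct (clim_bounded _ _ (qfin_cv (/ z * q) q Hq1)) as [b2 [P2 B2]].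
  destruct (clim_bounded _ _ (qfin_cv (z * q) q Hq1)) as [b3 [P3 B3]].
  destruct (qfin_inv_bounded q q Hq1 Hq1) as [b4 [P4 B4]].
  destruct (qfin_inv_bounded _ q Hq1 H4) as [b5 [P5 B5]].
  destruct (qfin_inv_bounded _ q Hq1 H3) as [b6 [P6 B6]].
  exists (b1 * b2 * b3 * (b4 * b5) * (b4 * b6))%R; split.
  - repeat apply Rmult_le_pos; lra.
  - intros n k; unfold wz_term, wz_weight, qq_inv.
    repeat apply Cmod_mult_le; auto; unfold g; rewrite Cmod_mult; lra. }
destruct Hbd as [B [HB Hbd]].
destruct Hg as (M & r & Hr & HM & Hg').
assert (HT : clim (psum (fun k => symterm g k * w)) (1 + z)).
(* The factor 2 pays for the pair [k], [- k]; the row sums are the finite identity with cutoff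
   [N = n]. *)
{ apply (tannery (fun n => symterm (wz_term z q n)) _ _ (2 * M * B)%R r).
  - lra.
  - repeat apply Rmult_le_pos; lra.
  - intros n [|k]; unfold symterm.
    + eapply Rle_trans; [apply Hbd|].
      specialize (Hg' 0%Z); simpl in *.
      pose proof (Cmod_ge_0 (g 0%Z)); nra.
    + eapply Rle_trans; [apply Cmod_triangle|].
      eapply Rle_trans; [apply Rplus_le_compat; apply Hbd|].
      pose proof (Hg' (Z.of_nat (S k))) as G1.
      pose proof (Hg' (- Z.of_nat (S k))%Z) as G2.
      replace (Z.abs_nat (- Z.of_nat (S k))) with (S k) in G2 by lia.
      rewrite Zabs2Nat.id in G1; nra.
  - intros [|k]; unfold symterm; [apply Hlim|].
    rewrite Cmult_plus_distr_r; apply clim_plus; apply Hlim.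
  - intros n; exists (S n); split; [lia|].
    apply finite_quintuple; auto. }
assert (HS : clim (psum (fun k => symterm g k * w)) (w * ZSeries g)).
{ apply (clim_ext (fun n => w * psum (symterm g) n)).
  - intros n; rewrite <- psum_scal; apply psum_ext; intros; ring.
  - apply clim_scal, clim_psum_symterm, zgeom_zlim.
    exists M, r; auto. }
rewrite <- (clim_unique _ _ _ HS HT); unfold w; field; auto.
Qed.

(** * The 7-dissection of Euler's product *)

Lemma Zdiv2_eq (e h : Z) : e = (2 * h)%Z -> (e / 2)%Z = h.
Proof. intros ->; rewrite Z.mul_comm; apply Z.div_mul; lia. Qed.

(** With [t = k (k + 1) / 2], half-integral quadratic exponents become linear in [t] and [k], which
    removes the integer divisions by 2. *)
Lemma square_plus_even (k : Z) : exists t, (k * k = 2 * t - k)%Z.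
Proof.
destruct (Z.Even_or_Odd k) as [[t ->]|[t ->]].
- exists (2 * t * t + t)%Z; ring.
- exists (2 * t * t + 3 * t + 1)%Z; ring.
Qed.

Lemma ZSeries_ext (f g : Z -> C) :
  zgeom f -> (forall m, f m = g m) -> ZSeries f = ZSeries g.
Proof.
intros Hf E; symmetry; apply zlim_ZSeries, (zlim_ext f); [exact E|].
now apply zgeom_zlim.
Qed.

Lemma zgeom_ext (f g : Z -> C) : (forall m, f m = g m) -> zgeom f -> zgeom g.
Proof.
intros E Hf; apply (zgeom_scal 1 f); [|exact Hf]; intros; rewrite E; ring.
Qed.

Lemma Cmod_pow_lt_1 (q : C) (n : nat) :
  (0 < Cmod q < 1)%R -> (0 < n)%nat -> (0 < Cmod (q ^ n) < 1)%R.
Proof.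
intros Hq Hn; rewrite Cmod_pow; split; [apply pow_lt; lra|].
apply Rle_lt_trans with (Cmod q ^ 1)%R; [|lra].
apply pow_antitone; assumption.
Qed.

(** * Pentagonal numbers and theta series *)

Definition pent (q : C) (k : Z) : C := (-1) ^^ k * q ^^ (k * (3 * k - 1) / 2).

Lemma pent_zgeom (q : C) : (0 < Cmod q < 1)%R -> zgeom (pent q).
Proof.
intros Hq; apply (zgeom_quadratic q _ _ 1 10 Hq).
- intros m; rewrite Cmod_m1_CpowZ; lra.
- intros m; destruct (square_plus_even m) as [t Ht].
  rewrite (Zdiv2_eq _ (3 * t - 2 * m)) by nia; nia.
Qed.

(** The quintuple product at [z = 1]: its summand is [pent q k + pent q (- k)], so both sides are
    twice the wanted ones once the remaining products cancel. *)
Lemma pentagonal_number_theorem (q : C) :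
  (0 < Cmod q < 1)%R -> ZSeries (pent q) = qpoch q q.
Proof.
intros Hq; assert (Hq0 : q <> 0) by (apply Cmod_gt_0; lra).
pose proof (pent_zgeom q Hq) as Hp.
assert (E1 : forall k, RtoC 1 ^^ k = 1).
{ intros [|p|p]; simpl; rewrite ?Cpow_1_l; try reflexivity; field. }
assert (E : forall k, pent q k + pent q (- k)
  = (1 + 1 * q ^^ k) * theta5 1 q k).
{ intros k; unfold pent, theta5; rewrite m1_CpowZ_opp, E1.
  replace (- k * (3 * - k - 1) / 2)%Z with (k + k * (3 * k - 1) / 2)%Z.
  - rewrite CpowZ_add by exact Hq0; ring.
  - destruct (square_plus_even k) as [t Ht].
    rewrite (Zdiv2_eq (k * (3 * k - 1)) (3 * t - 2 * k)) by nia.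
    rewrite (Zdiv2_eq (- k * (3 * - k - 1)) (3 * t - k)) by nia; lia. }
assert (Hs : zlim (fun k => pent q k + pent q (- k))
               (ZSeries (pent q) + ZSeries (pent q))).
{ apply (zlim_plus (pent q) (fun k => pent q (- k))); [|apply zlim_opp];
    now apply zgeom_zlim. }
apply (zlim_ext _ _ _ E) in Hs.
assert (Hg : zgeom (fun k => (1 + 1 * q ^^ k) * theta5 1 q k)).
{ apply (zgeom_ext _ _ E), zgeom_plus; [exact Hp|].
  destruct Hp as (M & r & Hr & HM & H).
  exists M, r; split; [exact Hr|]; split; [exact HM|].
  intros k; replace (Z.abs_nat k) with (Z.abs_nat (- k)) by lia; apply H. }
assert (Q1 : / 1 * q = q) by field.
assert (Q2 : / 1 ^ 2 * q = q) by field.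
assert (Q3 : 1 ^ 2 * q = q) by ring.
assert (Q4 : 1 * q = q) by ring.
pose proof (quintuple_product 1 q Hq C1_nz) as K.
rewrite Q1, Q2, Q3, Q4 in K.
specialize (K ltac:(lra) ltac:(lra) ltac:(lra) ltac:(lra) Hg).
rewrite (zlim_ZSeries _ _ Hs) in K.
destruct (qpoch_neq_0 q q ltac:(lra) ltac:(lra)) as [N _].
set (P := qpoch q q) in *; set (S := ZSeries (pent q)) in *.
replace S with ((S + S) * (P * P) * / (2 * P * P)) by (field; exact N).
rewrite K; field; exact N.
Qed.

(** The family of theta series containing both the residue classes modulo 7 of [pent] and the two
    parts of the quintuple series in base [q ^ 7]. *)
Definition tq (q : C) (j m : Z) : C := (-1) ^^ m * q ^^ ((21 * m ^ 2 + j * m) / 2).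

Lemma tq_exponent (j i m : Z) :
  j = (2 * i + 1)%Z -> exists e, (21 * m ^ 2 + j * m = 2 * e)%Z.
Proof.
intros ->; destruct (square_plus_even m) as [t Ht].
exists (21 * t + i * m - 10 * m)%Z; nia.
Qed.

Lemma tq_zgeom (q : C) (j : Z) :
  (0 < Cmod q < 1)%R -> (-25 <= j <= 25)%Z -> zgeom (tq q j).
Proof.
intros Hq Hj; apply (zgeom_quadratic q _ _ 1 20 Hq).
- intros m; rewrite Cmod_m1_CpowZ; lra.
- intros m; apply Z.div_le_lower_bound; [lia|].
  assert (- (25 * Z.abs m) <= j * m)%Z by nia. nia.
Qed.

Lemma tq_opp (q : C) (j : Z) :
  (0 < Cmod q < 1)%R -> (-25 <= j <= 25)%Z ->
  ZSeries (tq q (- j)) = ZSeries (tq q j).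
Proof.
intros Hq Hj; apply zlim_ZSeries.
apply (zlim_ext (fun m => tq q j (- m)%Z)).
- intros m; unfold tq; rewrite m1_CpowZ_opp; do 3 f_equal; ring.
- apply zlim_opp, zgeom_zlim, tq_zgeom; assumption.
Qed.

(** By [21 (m - 1)^2 + 25 (m - 1) = 21 m^2 - 17 m - 4], with a sign from the shift, then reflection.
    It reconciles the residue 3, where [j = 17], with the quintuple product at [a = 3], where
    [j = 25]. *)
Lemma tq_25 (q : C) :
  (0 < Cmod q < 1)%R -> q ^ 2 * ZSeries (tq q 25) = - ZSeries (tq q 17).
Proof.
intros Hq; assert (Hq0 : q <> 0) by (apply Cmod_gt_0; lra).
rewrite <- (tq_opp q 17 Hq) by lia; change (Z.opp 17) with (-17)%Z.
assert (H : zlim (fun m => tq q 25 (m - 1)) (ZSeries (tq q 25))).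
{ apply (zlim_shift (tq q 25)), zgeom_zlim, tq_zgeom; [exact Hq|lia]. }
apply (zlim_scal (- q ^ 2)) in H.
assert (E : ZSeries (tq q (-17)) = - q ^ 2 * ZSeries (tq q 25)).
{ apply zlim_ZSeries; refine (zlim_ext _ _ _ _ H); intros m; unfold tq.
  destruct (tq_exponent (-17) (-9) m ltac:(lia)) as [e He].
  rewrite (Zdiv2_eq _ e He), (Zdiv2_eq _ (e - Z.of_nat 2)) by nia.
  replace ((-1) ^^ m) with ((-1) ^^ ((m - 1) + 1)) by (f_equal; lia).
  rewrite m1_CpowZ_succ; replace e with (e - Z.of_nat 2 + Z.of_nat 2)%Z at 2 by lia.
  rewrite (CpowZ_add q (e - Z.of_nat 2)), CpowZ_nat by exact Hq0; ring. }
rewrite E; ring.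
Qed.

(** The quintuple product at [z = q ^ a] in base [q ^ 7]: the two summands of [1 + z q ^^ k] give
    the two series. The range of [a] keeps [7 - 2 a] positive. *)
Lemma tq_quintuple (q : C) (a : nat) :
  (0 < Cmod q < 1)%R -> (1 <= a <= 3)%nat ->
  ZSeries (tq q (6 * Z.of_nat a - 7)) + q ^ a * ZSeries (tq q (6 * Z.of_nat a + 7))
  = qpoch (q ^ 7) (q ^ 7) * qpoch (q ^ (2 * a)) (q ^ 7) * qpoch (q ^ (7 - 2 * a)) (q ^ 7)
    / (qpoch (q ^ a) (q ^ 7) * qpoch (q ^ (7 - a)) (q ^ 7)).
Proof.
intros Hq Ha; assert (Hq0 : q <> 0) by (apply Cmod_gt_0; lra).
assert (Hlt : forall n, (0 < n)%nat -> (Cmod (q ^ n) < 1)%R)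
  by (intros; apply Cmod_pow_lt_1; assumption).
pose proof (Cmod_pow_lt_1 q 7 Hq ltac:(lia)) as Hp.
assert (Hz : q ^ a <> 0) by (apply Cpow_nz, Hq0).
assert (E1 : / q ^ a * q ^ 7 = q ^ (7 - a)).
{ replace 7%nat with (a + (7 - a))%nat at 1 by lia; rewrite Cpow_add_r; field; exact Hz. }
assert (E2 : / (q ^ a) ^ 2 * q ^ 7 = q ^ (7 - 2 * a)).
{ replace 7%nat with (a + a + (7 - 2 * a))%nat at 1 by lia; rewrite !Cpow_add_r.
  field; exact Hz. }
assert (E3 : (q ^ a) ^ 2 = q ^ (2 * a)).
{ rewrite <- Cpow_mult_r; f_equal; lia. }
assert (E : forall k, tq q (6 * Z.of_nat a - 7) k + q ^ a * tq q (6 * Z.of_nat a + 7) k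
  = (1 + q ^ a * (q ^ 7) ^^ k) * theta5 (q ^ a) (q ^ 7) k).
{ intros k; unfold tq, theta5; rewrite !CpowZ_pow by exact Hq0.
  destruct (square_plus_even k) as [t Ht].
  set (A := Z.of_nat a).
  rewrite (Zdiv2_eq (k * (3 * k - 1)) (3 * t - 2 * k)) by nia.
  rewrite (Zdiv2_eq (21 * k ^ 2 + (6 * A - 7) * k)
             (A * (3 * k) + Z.of_nat 7 * (3 * t - 2 * k))) by nia.
  rewrite (Zdiv2_eq (21 * k ^ 2 + (6 * A + 7) * k)
             (A * (3 * k) + Z.of_nat 7 * (3 * t - 2 * k) + Z.of_nat 7 * k)) by nia.
  rewrite !CpowZ_add by exact Hq0; ring. }
pose proof (tq_zgeom q (6 * Z.of_nat a - 7) Hq ltac:(lia)) as G1.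
pose proof (tq_zgeom q (6 * Z.of_nat a + 7) Hq ltac:(lia)) as G2.
assert (Hg : zgeom (fun k => (1 + q ^ a * (q ^ 7) ^^ k) * theta5 (q ^ a) (q ^ 7) k)).
{ apply (zgeom_ext _ _ E), zgeom_plus; [exact G1|].
  now apply (zgeom_scal (q ^ a) (tq q (6 * Z.of_nat a + 7))). }
pose proof (quintuple_product (q ^ a) (q ^ 7) Hp Hz) as K.
rewrite E1, E2, E3, <- !Cpow_add_r in K.
specialize (K ltac:(apply Hlt; lia) ltac:(apply Hlt; lia) ltac:(apply Hlt; lia)
              ltac:(apply Hlt; lia) Hg).
assert (S : ZSeries (fun k => (1 + q ^ a * (q ^ 7) ^^ k) * theta5 (q ^ a) (q ^ 7) k)
  = ZSeries (tq q (6 * Z.of_nat a - 7)) + q ^ a * ZSeries (tq q (6 * Z.of_nat a + 7))).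
{ apply zlim_ZSeries; refine (zlim_ext _ _ _ E _).
  apply (zlim_plus _ (fun k => q ^ a * tq q (6 * Z.of_nat a + 7) k)).
  - now apply zgeom_zlim.
  - now apply zlim_scal, zgeom_zlim. }
rewrite S in K.
destruct (qpoch_neq_0 (q ^ a) (q ^ 7) ltac:(lra) ltac:(apply Hlt; lia)) as [N1 _].
destruct (qpoch_neq_0 (q ^ (7 - a)) (q ^ 7) ltac:(lra) ltac:(apply Hlt; lia)) as [N2 _].
(* The factor [1 + z = (1 - z^2) / (1 - z)] supplies the leading factors missing from the products
   that start at [q ^ (a + 7)] and [q ^ (2 a + 7)]. *)
rewrite (qpoch_head (q ^ a)), (qpoch_head (q ^ (2 * a))), <- !Cpow_add_r in * by lra.
rewrite <- E3 at 1.
set (s := _ + _) in *; set (z := q ^ a) in *.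
set (P1 := qpoch (q ^ (a + 7)) _) in *; set (P2 := qpoch (q ^ (7 - a)) _) in *.
assert (N3 : P1 <> 0) by (intros Z0; apply N1; rewrite Z0; ring).
assert (N4 : 1 - z <> 0) by (intros Z0; apply N1; rewrite Z0; ring).
replace s with (s * (P1 * P2) / (P1 * P2)) by (field; auto).
rewrite K; field; auto.
Qed.

Lemma theta_products_neq_0 (q : C) : (0 < Cmod q < 1)%R ->
  qpoch q (q ^ 7) <> 0 /\ qpoch (q ^ 2) (q ^ 7) <> 0 /\ qpoch (q ^ 3) (q ^ 7) <> 0 /\
  qpoch (q ^ 4) (q ^ 7) <> 0 /\ qpoch (q ^ 5) (q ^ 7) <> 0 /\ qpoch (q ^ 6) (q ^ 7) <> 0.
Proof.
intros Hq; assert (H : forall n, (0 < n)%nat -> (Cmod (q ^ n) < 1)%R)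
  by (intros; apply Cmod_pow_lt_1; assumption).
repeat split; apply qpoch_neq_0; try (apply H; lia); lra.
Qed.

(* [pent q (7 m + r)] is up to a power of [q] the term [tq (q ^ 7) (6 r - 1) m];
   the residues [0, -2], [1, -3] and [2, 3] pair up by the quintuple product,
   and [-1] is again pentagonal. *)
Lemma euler_dissect7 (q : C) :
  (0 < Cmod q < 1)%R ->
  qpoch q q = qpoch (q ^ 49) (q ^ 49) *
    (Lq (q ^ 7) / Nq (q ^ 7) - q * (Nq (q ^ 7) / Qq (q ^ 7)) - q ^ 2
     + q ^ 5 * (Qq (q ^ 7) / Lq (q ^ 7))).
Proof.
intros Hq; assert (Hq0 : q <> 0) by (apply Cmod_gt_0; lra).
pose proof (Cmod_pow_lt_1 q 7 Hq ltac:(lia)) as HQ.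
pose proof (pent_zgeom q Hq) as Hp.
rewrite <- (pentagonal_number_theorem q Hq), (ZSeries_dissect7 _ Hp).
(* [n = r (3 r - 1) / 2] is the exponent at [m = 0], and [s] is the sign there. *)
assert (K : forall (r j : Z) (n : nat) (s : C), (r * (3 * r - 1) = 2 * Z.of_nat n)%Z ->
  j = (6 * r - 1)%Z -> (-1) ^^ r = s ->
  forall f, (forall m, f m = pent q (7 * m + r)%Z) ->
  ZSeries f = s * q ^ n * ZSeries (tq (q ^ 7) j)).
{ intros r j n s Hr -> <- f Hf.
  apply (ZSeries_scal_of ((-1) ^^ r * q ^ n)).
  - apply Cmult_neq_0; [apply CpowZ_nz, m1_neq_0|apply Cpow_nz, Hq0].
  - apply (zgeom_ext (fun m => pent q (7 * m + r)%Z)); [auto|].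
    apply zgeom_affine; [lia|exact Hp].
  - intros m; rewrite Hf; unfold pent, tq; rewrite CpowZ_pow by exact Hq0.
    destruct (tq_exponent (6 * r - 1) (3 * r - 1) m ltac:(lia)) as [e He].
    rewrite (Zdiv2_eq _ e He).
    rewrite (Zdiv2_eq _ (Z.of_nat n + Z.of_nat 7 * e)) by nia.
    rewrite !CpowZ_add, CpowZ_nat by (exact Hq0 || apply m1_neq_0).
    change (7 * m)%Z with ((2 * 3 + 1) * m)%Z.
    rewrite m1_CpowZ_odd_mul; ring. }
rewrite (K (-3)%Z (-19)%Z 15%nat (-(1)) eq_refl eq_refl ltac:(simpl; field)
  (fun m => pent q (7 * m - 3)%Z)) by (intros; f_equal; lia).
rewrite (K (-2)%Z (-13)%Z 7%nat 1 eq_refl eq_refl ltac:(simpl; field)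
  (fun m => pent q (7 * m - 2)%Z)) by (intros; f_equal; lia).
rewrite (K (-1)%Z (-7)%Z 2%nat (-(1)) eq_refl eq_refl ltac:(simpl; field)
  (fun m => pent q (7 * m - 1)%Z)) by (intros; f_equal; lia).
rewrite (K (0)%Z (-1)%Z 0%nat 1 eq_refl eq_refl ltac:(simpl; field)
  (fun m => pent q (7 * m)%Z)) by (intros; f_equal; lia).
rewrite (K (1)%Z (5)%Z 1%nat (-(1)) eq_refl eq_refl ltac:(simpl; field)
  (fun m => pent q (7 * m + 1)%Z)) by (intros; f_equal; lia).
rewrite (K (2)%Z (11)%Z 5%nat 1 eq_refl eq_refl ltac:(simpl; field)
  (fun m => pent q (7 * m + 2)%Z)) by (intros; f_equal; lia).
rewrite (K (3)%Z (17)%Z 12%nat (-(1)) eq_refl eq_refl ltac:(simpl; field)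
  (fun m => pent q (7 * m + 3)%Z)) by (intros; f_equal; lia).
pose proof (tq_25 (q ^ 7) HQ) as T4.
pose proof (tq_opp (q ^ 7) 13 HQ ltac:(lia) : ZSeries (tq (q ^ 7) (-13)) = _) as T13.
pose proof (tq_opp (q ^ 7) 19 HQ ltac:(lia) : ZSeries (tq (q ^ 7) (-19)) = _) as T19.
assert (T7 : ZSeries (tq (q ^ 7) (-7)) = qpoch (q ^ 49) (q ^ 49)).
{ rewrite <- (pentagonal_number_theorem _ (Cmod_pow_lt_1 q 49 Hq ltac:(lia))).
  apply ZSeries_ext; [apply tq_zgeom; [exact HQ|lia]|].
  intros m; unfold tq, pent; rewrite !CpowZ_pow by exact Hq0.
  do 2 f_equal; destruct (square_plus_even m) as [t Ht].
  rewrite (Zdiv2_eq (m * (3 * m - 1)) (3 * t - 2 * m)) by nia.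
  rewrite (Zdiv2_eq _ (7 * (3 * t - 2 * m))) by nia; lia. }
rewrite T7, T13, T19.
transitivity (
  (ZSeries (tq (q ^ 7) (-1)) + (q ^ 7) ^ 1 * ZSeries (tq (q ^ 7) 13))
  - q * (ZSeries (tq (q ^ 7) 5) + (q ^ 7) ^ 2 * ZSeries (tq (q ^ 7) 19))
  - q ^ 2 * qpoch (q ^ 49) (q ^ 49)
  + q ^ 5 * (ZSeries (tq (q ^ 7) 11) + (q ^ 7) ^ 3 * ZSeries (tq (q ^ 7) 25))).
{ replace ((q ^ 7) ^ 3 * ZSeries (tq (q ^ 7) 25))
    with (q ^ 7 * ((q ^ 7) ^ 2 * ZSeries (tq (q ^ 7) 25))) by ring.
  rewrite T4; ring. }
(* With argument [q ^ 7], the values at [a = 1, 2, 3] are the product [(q^49;q^49)] times L/N, N/Q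
   and Q/L. *)
pose proof (tq_quintuple (q ^ 7) 1 HQ ltac:(lia)) as T1.
pose proof (tq_quintuple (q ^ 7) 2 HQ ltac:(lia)) as T2.
pose proof (tq_quintuple (q ^ 7) 3 HQ ltac:(lia)) as T3.
change (6 * Z.of_nat 1 - 7)%Z with (-1)%Z in T1.
change (6 * Z.of_nat 1 + 7)%Z with 13%Z in T1.
change (6 * Z.of_nat 2 - 7)%Z with 5%Z in T2.
change (6 * Z.of_nat 2 + 7)%Z with 19%Z in T2.
change (6 * Z.of_nat 3 - 7)%Z with 11%Z in T3.
change (6 * Z.of_nat 3 + 7)%Z with 25%Z in T3.
rewrite T1, T2, T3; clear - Hq HQ.
cbn [Nat.mul Nat.add Nat.sub]; rewrite (Cpow_1_r (q ^ 7)).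
replace (q ^ 49) with ((q ^ 7) ^ 7) by ring.
pose proof (theta_products_neq_0 (q ^ 7) HQ) as (N1 & N2 & N3 & N4 & N5 & N6).
unfold Lq, Nq, Qq, qpochs; cbn [map fold_right].
field; repeat split; assumption.
Qed.

(** * The 7-dissection of the left-hand series *)

Lemma ZSeries_nz_eq (f : Z -> C) : zgeom f -> f 0%Z = 0 -> ZSeries_nz f = ZSeries f.
Proof.
intros Hf%zgeom_zlim H0; destruct Hf as (l1 & l2 & H1 & H2 & E).
rewrite E; unfold ZSeries_nz; apply clim_psum_S in H1.
rewrite (CSeries_psum _ _ H1), (CSeries_psum _ _ H2); simpl; rewrite H0; ring.
Qed.

Lemma aterm_junk (q : C) (e : Z) : aterm q 0 e (7 * 0) = 0.
Proof.
unfold aterm; simpl; replace (1 - 1) with (RtoC 0) by ring.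
unfold Cdiv; rewrite Cinv_0; ring.
Qed.

Definition rank_term (q : C) (b n : Z) : C :=
  (-1) ^^ n * (q ^^ (n * (n + 1) / 2 + b * n) / (1 - q ^^ (7 * n))).

Lemma rank_term_zgeom (q : C) (b : Z) :
  (0 < Cmod q < 1)%R -> (0 <= b <= 2)%Z -> zgeom (rank_term q b).
Proof.
intros Hq Hb.
apply (zgeom_ext (fun n => (-1) ^^ n * / (1 - q ^^ (7 * n))
  * q ^^ (n * (n + 1) / 2 + b * n))).
- intros n; unfold rank_term, Cdiv; ring.
- apply (zgeom_quadratic q _ _ (1 * / (1 - Cmod q)) 10 Hq).
  + intros m; apply Cmod_mult_le.
    * rewrite Cmod_m1_CpowZ; lra.
    * now apply Cmod_inv_1_minus_le.
  + intros m; destruct (square_plus_even m) as [t Ht].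
    rewrite (Zdiv2_eq _ t) by nia.
    assert (- (2 * Z.abs m) <= b * m)%Z by nia. nia.
Qed.

(** The constant [r (r + 1) / 2 + b r] is split as [c + 7 d]: [c] becomes the outer power of [q],
    while [d] enters the series in [q ^ 7] as the constant [2 d] of its exponent. *)
Lemma rank_term_dissect (q : C) (b r d : Z) (c : nat) (s : C) (f : Z -> C)
  (e u : Z -> Z) :
  (0 < Cmod q < 1)%R -> (0 <= b <= 2)%Z -> (-1) ^^ r = s ->
  (r * (r + 1) + 2 * b * r = 2 * (Z.of_nat c + 7 * d))%Z ->
  (forall m, f m = rank_term q b (7 * m + r)) ->
  (forall m, e m = 7 * m ^ 2 + (2 * r + 1 + 2 * b) * m + 2 * d)%Z ->
  (forall m, u m = 7 * m + r)%Z ->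
  zgeom (fun m => aterm (q ^ 7) m (e m) (u m)) /\
  ZSeries f = s * q ^ c * ZSeries (fun m => aterm (q ^ 7) m (e m) (u m)).
Proof.
intros Hq Hb <- Hc Hf He Hu; assert (Hq0 : q <> 0) by (apply Cmod_gt_0; lra).
apply ZSeries_scal_of.
- apply Cmult_neq_0; [apply CpowZ_nz, m1_neq_0|apply Cpow_nz, Hq0].
- apply (zgeom_ext (fun m => rank_term q b (7 * m + r))); [auto|].
  apply zgeom_affine; [lia|now apply rank_term_zgeom].
- intros m; rewrite Hf, He, Hu; unfold rank_term, aterm.
  destruct (square_plus_even m) as [t Ht].
  rewrite !CpowZ_pow by exact Hq0.
  rewrite (Zdiv2_eq (7 * m ^ 2 + (2 * r + 1 + 2 * b) * m + 2 * d)
             (7 * t + (r + b - 3) * m + d)) by nia.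
  replace ((7 * m + r) * (7 * m + r + 1) / 2 + b * (7 * m + r))%Z
    with (Z.of_nat c + Z.of_nat 7 * (7 * t + (r + b - 3) * m + d))%Z.
  + rewrite !CpowZ_add, CpowZ_nat by (exact Hq0 || apply m1_neq_0).
    change (7 * m)%Z with ((2 * 3 + 1) * m)%Z at 1.
    rewrite m1_CpowZ_odd_mul; unfold Cdiv; simpl Z.of_nat; ring.
  + rewrite (Zdiv2_eq ((7 * m + r) * (7 * m + r + 1))
      (Z.of_nat c + Z.of_nat 7 * (7 * t + (r + b - 3) * m + d) - b * (7 * m + r)))
      by nia; lia.
Qed.

(** With [x = q ^ n], [(1 - x)^5 (1 + x) = 1 - 4 x + 5 x^2 - 5 x^4 + 4 x^5 - x^6]. Replacing [n] by
    [- n] carries the term with [x^b] to minus the term with [x^(6 - b)], so the last three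
    coefficients are the first three at negative indices. *)
Lemma rank_series (q : C) :
  (0 < Cmod q < 1)%R ->
  CSeries (fun k => let n := S k in
      (-1) ^ n * q ^ (n * (n + 1) / 2) * (1 - q ^ n) ^ 5 * (1 + q ^ n)
      / (1 - q ^ (7 * n)))
  = ZSeries (rank_term q 0) - 4 * ZSeries (rank_term q 1) + 5 * ZSeries (rank_term q 2).
Proof.
intros Hq; assert (Hq0 : q <> 0) by (apply Cmod_gt_0; lra).
assert (Hz : forall b, (0 <= b <= 2)%Z -> zlim (rank_term q b) (ZSeries (rank_term q b)))
  by (intros; now apply zgeom_zlim, rank_term_zgeom).
pose proof (zlim_plus _ _ _ _ (zlim_plus _ _ _ _ (Hz 0%Z ltac:(lia))
  (zlim_scal (- 4) _ _ (Hz 1%Z ltac:(lia)))) (zlim_scal 5 _ _ (Hz 2%Z ltac:(lia)))) as H.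
apply clim_psum_symterm, clim_psum_S in H; apply CSeries_psum.
match type of H with clim _ (?l - ?z) =>
  replace (ZSeries (rank_term q 0) - 4 * ZSeries (rank_term q 1)
           + 5 * ZSeries (rank_term q 2)) with (l - z) end.
- refine (clim_ext _ _ _ _ H); intros N; apply psum_ext; intros k _.
  unfold symterm; cbv zeta; set (n := S k).
  assert (Hn : 1 - q ^ (7 * n) <> 0).
  { replace (7 * n)%nat with (S (7 * k + 6)) by (unfold n; lia).
    apply Cmod_lt_1_pow_neq_1; lra. }
  assert (Hx : q ^ n <> 0) by (apply Cpow_nz, Hq0).
  unfold rank_term; rewrite !m1_CpowZ_opp, !CpowZ_nat.
  destruct (square_plus_even (Z.of_nat n)) as [t Ht].
  assert (Ht' : (n * (n + 1) / 2)%nat = Z.to_nat t).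
  { apply Nat2Z.inj; rewrite Nat2Z.inj_div, Nat2Z.inj_mul, Nat2Z.inj_add.
    simpl (Z.of_nat 1); simpl (Z.of_nat 2).
    rewrite (Zdiv2_eq _ t) by nia; nia. }
  rewrite Ht'.
  rewrite (Zdiv2_eq (Z.of_nat n * (Z.of_nat n + 1)) t) by nia.
  rewrite (Zdiv2_eq (- Z.of_nat n * (- Z.of_nat n + 1)) (t + - Z.of_nat n)) by nia.
  assert (0 <= t)%Z by nia; replace t with (Z.of_nat (Z.to_nat t)) by lia; set (T := Z.to_nat t).
  rewrite Nat2Z.id.
  change 7%Z with (Z.of_nat 7).
  replace (Z.of_nat 7 * - Z.of_nat n)%Z with (- (Z.of_nat (7 * n)))%Z by lia.
  rewrite <- Nat2Z.inj_mul.
  change (2 * - Z.of_nat n)%Z with ((1 + 1) * - Z.of_nat n)%Z.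
  change (2 * Z.of_nat n)%Z with ((1 + 1) * Z.of_nat n)%Z.
  rewrite !Z.mul_0_l, !Z.mul_add_distr_r, !Z.mul_1_l, !Z.add_0_r.
  rewrite !CpowZ_add, !CpowZ_opp_nat, !CpowZ_nat by exact Hq0.
  rewrite (Nat.mul_comm 7 n), Cpow_mult_r in *.
  set (x := q ^ n) in *; set (y := q ^ T); set (s := (-1) ^ n).
  (* This denominator comes from [1 - x^(-7)] at the index [- n]. *)
  assert (Hn' : x ^ 7 - 1 <> 0).
  { intros E; apply Hn; replace (1 - x ^ 7) with (- (x ^ 7 - 1)) by ring.
    rewrite E; ring. }
  field; auto.
- assert (Z0 : forall b, rank_term q b 0 = 0).
  { intros b; unfold rank_term; rewrite !Z.mul_0_r; simpl.
    replace (1 - 1) with (RtoC 0) by ring.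
    unfold Cdiv; rewrite Cinv_0; ring. }
  unfold symterm; rewrite !Z0; ring.
Qed.

(** * Comparison of the two sides, class by class modulo 7 *)

Theorem theorem5p2 :
  (forall q : C, (0 < Cmod q < 1)%R ->
     - ZSeries (fun m => aterm q m (7*m^2 + 3*m) (7*m + 1))
     + ZSeries (fun m => aterm q m (7*m^2 - 3*m) (7*m - 2))
     = qpoch (q ^ 7) (q ^ 7) ^ 2 * (- (Lq q ^ 2 / Nq q) + q * (Qq q * Nq q / Lq q))) ->
  (forall q : C, (0 < Cmod q < 1)%R ->
     4 * ZSeries (fun m => aterm q m (7*m^2 + 5*m) (7*m + 1))
     + 4 * ZSeries (fun m => aterm q m (7*m^2 + 9*m + 2) (7*m + 3))
     = qpoch (q ^ 7) (q ^ 7) ^ 2 * (Lq q * Nq q / Qq q + 3 * (Lq q ^ 2 * Qq q / Nq q ^ 2)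
          + q * (Qq q ^ 2 / Lq q))) ->
  (forall q : C, (0 < Cmod q < 1)%R ->
     ZSeries (fun m => aterm q m (7*m^2 + 5*m) (7*m + 2))
     - ZSeries (fun m => aterm q m (7*m^2 - 5*m) (7*m - 3))
     - 5 * ZSeries (fun m => aterm q m (7*m^2 + 7*m) (7*m + 1))
     = - 4 * qpoch (q ^ 7) (q ^ 7) ^ 2 * Lq q) ->
  (forall q : C, (0 < Cmod q < 1)%R ->
     5 * ZSeries (fun m => aterm q m (7*m^2 + m - 2) (7*m - 2))
     - 5 * ZSeries (fun m => aterm q m (7*m^2 - m - 2) (7*m - 3))
     = qpoch (q ^ 7) (q ^ 7) ^ 2 * (2 * (Nq q ^ 2 / Qq q) - 2 * (Lq q * Qq q / Nq q)
          - 3 * q * (Qq q ^ 2 * Nq q / Lq q ^ 2))) ->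
  (forall q : C, (0 < Cmod q < 1)%R ->
     - 4 * ZSeries (fun m => aterm q m (7*m^2 + 7*m) (7*m + 2))
     - 5 * ZSeries (fun m => aterm q m (7*m^2 + 3*m - 2) (7*m - 1))
     - 5 * ZSeries (fun m => aterm q m (7*m^2 + 11*m + 2) (7*m + 3))
     = qpoch (q ^ 7) (q ^ 7) ^ 2 * Nq q) ->
  (forall q : C, (0 < Cmod q < 1)%R ->
     - ZSeries (fun m => aterm q m (7*m^2 + 7*m) (7*m + 3))
     + 4 * ZSeries (fun m => aterm q m (7*m^2 + m - 2) (7*m - 1))
     - 4 * ZSeries (fun m => aterm q m (7*m^2 - m - 2) (7*m - 2))
     = - 5 * qpoch (q ^ 7) (q ^ 7) ^ 2 * Qq q) ->
  (forall q : C, (0 < Cmod q < 1)%R ->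
     ZSeries_nz (fun m => aterm q m (7*m^2 + m - 2) (7*m))
     - ZSeries (fun m => aterm q m (7*m^2 - m - 2) (7*m - 1))
     - 4 * ZSeries_nz (fun m => aterm q m (7*m^2 + 3*m - 2) (7*m))
     + 4 * ZSeries (fun m => aterm q m (7*m^2 - 3*m - 2) (7*m - 3))
     + 5 * ZSeries_nz (fun m => aterm q m (7*m^2 + 5*m - 2) (7*m))
     + 5 * ZSeries (fun m => aterm q m (7*m^2 + 9*m) (7*m + 2))
     = 3 * qpoch (q ^ 7) (q ^ 7) ^ 2 * (Qq q ^ 2 / Nq q + Nq q ^ 2 / Lq q)) ->
  forall q : C, (0 < Cmod q < 1)%R ->
    1 / qpoch q q
    * CSeries (fun k => let n := S k in
        (-1) ^ n * q ^ (n * (n + 1) / 2) * (1 - q ^ n) ^ 5 * (1 + q ^ n)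
        / (1 - q ^ (7 * n)))
    = - q * prodA q + 3 * q ^ 2 * prodB q - 2 * q ^ 3 * prodC q + q ^ 4 * prodD q
      - 3 * q ^ 6 * prodE q.

Proof.
intros I1 I2 I3 I4 I5 I6 I7 q Hq.
pose proof (Cmod_pow_lt_1 q 7 Hq ltac:(lia)) as HQ.
specialize (I1 _ HQ); specialize (I2 _ HQ); specialize (I3 _ HQ); specialize (I4 _ HQ).
specialize (I5 _ HQ); specialize (I6 _ HQ); specialize (I7 _ HQ).
rewrite (rank_series q Hq).
rewrite (ZSeries_dissect7 (rank_term q 0)), (ZSeries_dissect7 (rank_term q 1)),
  (ZSeries_dissect7 (rank_term q 2)) by (apply rank_term_zgeom; [exact Hq|lia]).
(* In the 21 cases [c] is taken in 1 to 7, so that [c] is the position of the identity that absorbs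
   the series. The bound is kept only at [r = 0], where (vii) has primed sums. *)
destruct (rank_term_dissect q 0 (-3) (0) 3 (-(1)) (fun m => rank_term q 0 (7*m - 3)%Z)
  (fun m => 7*m^2 - 5*m)%Z (fun m => 7*m - 3)%Z Hq ltac:(lia) ltac:(simpl; field)
  eq_refl ltac:(intros; cbv beta; f_equal; ring) ltac:(intros; ring) ltac:(intros; ring)) as [_ ->].
destruct (rank_term_dissect q 0 (-2) (0) 1 1 (fun m => rank_term q 0 (7*m - 2)%Z)
  (fun m => 7*m^2 - 3*m)%Z (fun m => 7*m - 2)%Z Hq ltac:(lia) ltac:(simpl; field)
  eq_refl ltac:(intros; cbv beta; f_equal; ring) ltac:(intros; ring) ltac:(intros; ring)) as [_ ->].
destruct (rank_term_dissect q 0 (-1) (-1) 7 (-(1)) (fun m => rank_term q 0 (7*m - 1)%Z)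
  (fun m => 7*m^2 - m - 2)%Z (fun m => 7*m - 1)%Z Hq ltac:(lia) ltac:(simpl; field)
  eq_refl ltac:(intros; cbv beta; f_equal; ring) ltac:(intros; ring) ltac:(intros; ring)) as [_ ->].
destruct (rank_term_dissect q 0 (0) (-1) 7 1 (fun m => rank_term q 0 (7*m)%Z)
  (fun m => 7*m^2 + m - 2)%Z (fun m => 7*m)%Z Hq ltac:(lia) ltac:(simpl; field)
  eq_refl ltac:(intros; cbv beta; f_equal; ring) ltac:(intros; ring) ltac:(intros; ring)) as [G0 ->].
destruct (rank_term_dissect q 0 (1) (0) 1 (-(1)) (fun m => rank_term q 0 (7*m + 1)%Z)
  (fun m => 7*m^2 + 3*m)%Z (fun m => 7*m + 1)%Z Hq ltac:(lia) ltac:(simpl; field)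
  eq_refl ltac:(intros; cbv beta; f_equal; ring) ltac:(intros; ring) ltac:(intros; ring)) as [_ ->].
destruct (rank_term_dissect q 0 (2) (0) 3 1 (fun m => rank_term q 0 (7*m + 2)%Z)
  (fun m => 7*m^2 + 5*m)%Z (fun m => 7*m + 2)%Z Hq ltac:(lia) ltac:(simpl; field)
  eq_refl ltac:(intros; cbv beta; f_equal; ring) ltac:(intros; ring) ltac:(intros; ring)) as [_ ->].
destruct (rank_term_dissect q 0 (3) (0) 6 (-(1)) (fun m => rank_term q 0 (7*m + 3)%Z)
  (fun m => 7*m^2 + 7*m)%Z (fun m => 7*m + 3)%Z Hq ltac:(lia) ltac:(simpl; field)
  eq_refl ltac:(intros; cbv beta; f_equal; ring) ltac:(intros; ring) ltac:(intros; ring)) as [_ ->].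
destruct (rank_term_dissect q 1 (-3) (-1) 7 (-(1)) (fun m => rank_term q 1 (7*m - 3)%Z)
  (fun m => 7*m^2 - 3*m - 2)%Z (fun m => 7*m - 3)%Z Hq ltac:(lia) ltac:(simpl; field)
  eq_refl ltac:(intros; cbv beta; f_equal; ring) ltac:(intros; ring) ltac:(intros; ring)) as [_ ->].
destruct (rank_term_dissect q 1 (-2) (-1) 6 1 (fun m => rank_term q 1 (7*m - 2)%Z)
  (fun m => 7*m^2 - m - 2)%Z (fun m => 7*m - 2)%Z Hq ltac:(lia) ltac:(simpl; field)
  eq_refl ltac:(intros; cbv beta; f_equal; ring) ltac:(intros; ring) ltac:(intros; ring)) as [_ ->].
destruct (rank_term_dissect q 1 (-1) (-1) 6 (-(1)) (fun m => rank_term q 1 (7*m - 1)%Z)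
  (fun m => 7*m^2 + m - 2)%Z (fun m => 7*m - 1)%Z Hq ltac:(lia) ltac:(simpl; field)
  eq_refl ltac:(intros; cbv beta; f_equal; ring) ltac:(intros; ring) ltac:(intros; ring)) as [_ ->].
destruct (rank_term_dissect q 1 (0) (-1) 7 1 (fun m => rank_term q 1 (7*m)%Z)
  (fun m => 7*m^2 + 3*m - 2)%Z (fun m => 7*m)%Z Hq ltac:(lia) ltac:(simpl; field)
  eq_refl ltac:(intros; cbv beta; f_equal; ring) ltac:(intros; ring) ltac:(intros; ring)) as [G1 ->].
destruct (rank_term_dissect q 1 (1) (0) 2 (-(1)) (fun m => rank_term q 1 (7*m + 1)%Z)
  (fun m => 7*m^2 + 5*m)%Z (fun m => 7*m + 1)%Z Hq ltac:(lia) ltac:(simpl; field)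
  eq_refl ltac:(intros; cbv beta; f_equal; ring) ltac:(intros; ring) ltac:(intros; ring)) as [_ ->].
destruct (rank_term_dissect q 1 (2) (0) 5 1 (fun m => rank_term q 1 (7*m + 2)%Z)
  (fun m => 7*m^2 + 7*m)%Z (fun m => 7*m + 2)%Z Hq ltac:(lia) ltac:(simpl; field)
  eq_refl ltac:(intros; cbv beta; f_equal; ring) ltac:(intros; ring) ltac:(intros; ring)) as [_ ->].
destruct (rank_term_dissect q 1 (3) (1) 2 (-(1)) (fun m => rank_term q 1 (7*m + 3)%Z)
  (fun m => 7*m^2 + 9*m + 2)%Z (fun m => 7*m + 3)%Z Hq ltac:(lia) ltac:(simpl; field)
  eq_refl ltac:(intros; cbv beta; f_equal; ring) ltac:(intros; ring) ltac:(intros; ring)) as [_ ->].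
destruct (rank_term_dissect q 2 (-3) (-1) 4 (-(1)) (fun m => rank_term q 2 (7*m - 3)%Z)
  (fun m => 7*m^2 - m - 2)%Z (fun m => 7*m - 3)%Z Hq ltac:(lia) ltac:(simpl; field)
  eq_refl ltac:(intros; cbv beta; f_equal; ring) ltac:(intros; ring) ltac:(intros; ring)) as [_ ->].
destruct (rank_term_dissect q 2 (-2) (-1) 4 1 (fun m => rank_term q 2 (7*m - 2)%Z)
  (fun m => 7*m^2 + m - 2)%Z (fun m => 7*m - 2)%Z Hq ltac:(lia) ltac:(simpl; field)
  eq_refl ltac:(intros; cbv beta; f_equal; ring) ltac:(intros; ring) ltac:(intros; ring)) as [_ ->].
destruct (rank_term_dissect q 2 (-1) (-1) 5 (-(1)) (fun m => rank_term q 2 (7*m - 1)%Z)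
  (fun m => 7*m^2 + 3*m - 2)%Z (fun m => 7*m - 1)%Z Hq ltac:(lia) ltac:(simpl; field)
  eq_refl ltac:(intros; cbv beta; f_equal; ring) ltac:(intros; ring) ltac:(intros; ring)) as [_ ->].
destruct (rank_term_dissect q 2 (0) (-1) 7 1 (fun m => rank_term q 2 (7*m)%Z)
  (fun m => 7*m^2 + 5*m - 2)%Z (fun m => 7*m)%Z Hq ltac:(lia) ltac:(simpl; field)
  eq_refl ltac:(intros; cbv beta; f_equal; ring) ltac:(intros; ring) ltac:(intros; ring)) as [G2 ->].
destruct (rank_term_dissect q 2 (1) (0) 3 (-(1)) (fun m => rank_term q 2 (7*m + 1)%Z)
  (fun m => 7*m^2 + 7*m)%Z (fun m => 7*m + 1)%Z Hq ltac:(lia) ltac:(simpl; field)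
  eq_refl ltac:(intros; cbv beta; f_equal; ring) ltac:(intros; ring) ltac:(intros; ring)) as [_ ->].
destruct (rank_term_dissect q 2 (2) (0) 7 1 (fun m => rank_term q 2 (7*m + 2)%Z)
  (fun m => 7*m^2 + 9*m)%Z (fun m => 7*m + 2)%Z Hq ltac:(lia) ltac:(simpl; field)
  eq_refl ltac:(intros; cbv beta; f_equal; ring) ltac:(intros; ring) ltac:(intros; ring)) as [_ ->].
destruct (rank_term_dissect q 2 (3) (1) 5 (-(1)) (fun m => rank_term q 2 (7*m + 3)%Z)
  (fun m => 7*m^2 + 11*m + 2)%Z (fun m => 7*m + 3)%Z Hq ltac:(lia) ltac:(simpl; field)
  eq_refl ltac:(intros; cbv beta; f_equal; ring) ltac:(intros; ring) ltac:(intros; ring)) as [_ ->].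
cbv beta in *.
rewrite (ZSeries_nz_eq _ G0), (ZSeries_nz_eq _ G1), (ZSeries_nz_eq _ G2) in I7
  by apply aterm_junk.
replace ((q ^ 7) ^ 7) with (q ^ 49) in * by ring.
pose proof (euler_dissect7 q Hq) as HP.
destruct (qpoch_neq_0 q q ltac:(lra) ltac:(lra)) as [NP _].
destruct (theta_products_neq_0 (q ^ 7) HQ) as (N1 & N2 & N3 & N4 & N5 & N6).
replace ((q ^ 7) ^ 7) with (q ^ 49) in * by ring.
match type of I1 with ?l1 = ?r1 => match type of I2 with ?l2 = ?r2 =>
match type of I3 with ?l3 = ?r3 => match type of I4 with ?l4 = ?r4 =>
match type of I5 with ?l5 = ?r5 => match type of I6 with ?l6 = ?r6 =>
match type of I7 with ?l7 = ?r7 => match goal with |- _ * ?s = ?r =>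
  transitivity (1 / qpoch q q * (q * l1 + q ^ 2 * l2 + q ^ 3 * l3 + q ^ 4 * l4
    + q ^ 5 * l5 + q ^ 6 * l6 + q ^ 7 * l7)); [f_equal; ring|];
  rewrite I1, I2, I3, I4, I5, I6, I7;
  assert (K : q * r1 + q ^ 2 * r2 + q ^ 3 * r3 + q ^ 4 * r4 + q ^ 5 * r5
    + q ^ 6 * r6 + q ^ 7 * r7 = qpoch q q * r)
end end end end end end end end.
(* A rational identity in which the six products and [(q^49;q^49)] act as indeterminates. The
   products of total degree 8, 9 and 11 in the outer powers of [q] supply the terms with an explicit
   factor [q] in (i), (ii) and (iv), evaluated at [q ^ 7]. *)
{ rewrite HP; clear - N1 N2 N3 N4 N5 N6.
  unfold prodA, prodB, prodC, prodD, prodE, Lq, Nq, Qq, qpochs; cbn [map fold_right].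
  replace (q ^ 14) with ((q ^ 7) ^ 2) by ring.
  replace (q ^ 21) with ((q ^ 7) ^ 3) by ring.
  replace (q ^ 28) with ((q ^ 7) ^ 4) by ring.
  replace (q ^ 35) with ((q ^ 7) ^ 5) by ring.
  replace (q ^ 42) with ((q ^ 7) ^ 6) by ring.
  replace ((q ^ 7) ^ 7) with (q ^ 49) in * by ring.
  set (Q1 := qpoch (q ^ 7) _) in *; set (Q2 := qpoch ((q ^ 7) ^ 2) _) in *.
  set (Q3 := qpoch ((q ^ 7) ^ 3) _) in *; set (Q4 := qpoch ((q ^ 7) ^ 4) _) in *.
  set (Q5 := qpoch ((q ^ 7) ^ 5) _) in *; set (Q6 := qpoch ((q ^ 7) ^ 6) _) in *.
  field; repeat split; assumption. }
rewrite K; field; exact NP.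
Qed.
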